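(* Let $0<\alpha<2$ and let $Z=Z^{(n)}$ be the sparse random matrix $Z_{ij}=X_{ij}Y_{ij}$, where $X$ is the adjacency matrix of the Erdős–Rényi graph $\mathcal G_{n,d/n}$ and $Y$ has i.i.d. Weibull entries with shape parameter $\alpha$ (all as described in the context). Then $$\lim_{n\to\infty}\frac{\lambda_1(Z)}{(\log n)^{1/\alpha}}=1$$ in probability.
   Context: $d>0$ is a fixed constant. $X=(X_{ij})_{i,j\in[n]}$ is the adjacency matrix of the Erdős–Rényi graph $\mathcal G_{n,p}$ on vertex set $[n]=\{1,\dots,n\}$ with $p=d/n$. $Y=(Y_{ij})_{i,j\in[n]}$ is a random symmetric matrix, independent of $X$, with $Y_{ii}=0$, $Y_{ij}=Y_{ji}$ and $\{Y_{ij}\}_{1\le i<j\le n}$ i.i.d. with a Weibull distribution with shape parameter $\alpha$ (whose law does not depend on $n$). A random variable $W$ has a Weibull distribution with shape parameter $\alpha>0$ if there exist constants $C_1,C_2>0$ such that for all $t>1$, $\frac{C_1}{2}e^{-t^\alpha}\le \mathbb P(W\ge t)\le\frac{C_2}{2}e^{-t^\alpha}$ and $\frac{C_1}{2}e^{-t^\alpha}\le\mathbb P(W\le -t)\le\frac{C_2}{2}e^{-t^\alpha}$. $Z$ is the entrywise product, $Z_{ij}=X_{ij}Y_{ij}$. $\lambda_1(Z)$ denotes the largest eigenvalue of the symmetric matrix $Z$. *)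

(* Defs.v *)
From HB Require Import structures.
From mathcomp Require Import all_boot all_order all_algebra.
From mathcomp Require Import all_classical all_reals all_analysis.

Set Implicit Arguments.
Unset Strict Implicit.
Unset Printing Implicit Defensive.

Import Order.TTheory GRing.Theory Num.Theory.
Import numFieldNormedType.Exports.

Local Open Scope classical_set_scope.
Local Open Scope ring_scope.

(* The [sup] is a maximum when [M] is symmetric and [0 < n]: the spectrum of
   such a matrix is finite and nonempty. *)
Definition lambda1 (R : realType) (n : nat) (M : 'M[R]_n) : R :=
  sup [set a : R | eigenvalue M a].

Definition adjacency_mx (R : realType) (n : nat) (g : rel 'I_n) : 'M[R]_n :=
  \matrix_(i < n, j < n) (g i j)%:R.

Definition hadamard (R : realType) (n : nat) (A B : 'M[R]_n) : 'M[R]_n :=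
  \matrix_(i < n, j < n) (A i j * B i j).

Definition upper_pair (n : nat) : {pred 'I_n * 'I_n} :=
  [pred e : 'I_n * 'I_n | (e.1 < e.2)%N].

Definition sigma_rv (d d' : measure_display) (T : measurableType d)
    (U : measurableType d') (f : T -> U) : set (set T) :=
  preimage_set_system setT f measurable.

Definition sigma_mx (d : measure_display) (T : measurableType d)
    (R : realType) (n : nat) (M : T -> 'M[R]_n) : set (set T) :=
  <<s \bigcup_(e in [set: 'I_n * 'I_n]) sigma_rv (fun w => M w e.1 e.2) >>.

Definition independent (d : measure_display) (T : measurableType d)
    (R : realType) (P : probability T R) (F G : set (set T)) : Prop :=
  forall A B : set T, F A -> G B -> P (A `&` B) = (P A * P B)%E.

Definition mutually_independent (d : measure_display) (T : measurableType d)
    (R : realType) (P : probability T R) (I : finType) (D : {pred I})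
    (F : I -> set (set T)) : Prop :=
  forall (J : {set I}) (A : I -> set T),
    {subset J <= D} -> (forall i, i \in J -> F i (A i)) ->
    P (\bigcap_(i in [set` J]) A i) = (\prod_(i in J) P (A i))%E.

Definition erdos_renyi (d : measure_display) (T : measurableType d)
    (R : realType) (P : probability T R) (n : nat) (p : R)
    (G : T -> rel 'I_n) : Prop :=
  [/\ forall w, symmetric (G w) /\ irreflexive (G w),
      forall i j : 'I_n, (i < j)%N ->
        measurable [set w | G w i j] /\ P [set w | G w i j] = p%:E
    & mutually_independent P (@upper_pair n)
        (fun e => sigma_rv (fun w => G w e.1 e.2))].

(* The defining tail bounds constrain only the law [mu] of the variable:
   P(W >= t) = mu [t, +oo[ and P(W <= -t) = mu ]-oo, -t]. *)
Definition weibull (R : realType) (alpha : R) (mu : probability R R) : Prop :=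
  exists C1 C2 : R, [/\ 0 < C1, 0 < C2
    & forall t : R, 1 < t ->
      ((C1 / 2 * expR (- (t `^ alpha)))%R%:E <= mu [set x : R | (t <= x)%R]
          <= (C2 / 2 * expR (- (t `^ alpha)))%R%:E)%E /\
      ((C1 / 2 * expR (- (t `^ alpha)))%R%:E <= mu [set x : R | (x <= - t)%R]
          <= (C2 / 2 * expR (- (t `^ alpha)))%R%:E)%E].

Definition has_law (d : measure_display) (T : measurableType d)
    (R : realType) (P : probability T R) (f : T -> R)
    (mu : probability R R) : Prop :=
  measurable_fun setT f /\
  forall A : set R, measurable A -> P (f @^-1` A) = mu A.

Definition iid_symmetric_mx (d : measure_display) (T : measurableType d)
    (R : realType) (P : probability T R) (n : nat) (mu : probability R R)
    (Y : T -> 'M[R]_n) : Prop :=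
  [/\ forall w i, Y w i i = 0,
      forall w i j, Y w i j = Y w j i,
      forall i j : 'I_n, (i < j)%N -> has_law P (fun w => Y w i j) mu
    & mutually_independent P (@upper_pair n)
        (fun e => sigma_rv (fun w => Y w e.1 e.2))].

(* The spaces may vary with [n], as the limit is a constant. *)
Definition cvg_in_probability (R : realType) (disp : nat -> measure_display)
    (T : forall n, measurableType (disp n))
    (P : forall n, probability (T n) R) (V : forall n, T n -> R)
    (l : R) : Prop :=
  forall eps : R, 0 < eps ->
    P n [set w | eps <= `|V n w - l|] @[n --> \oo] --> 0%E.

(* Main.v *)
Require Import Defs.
From HB Require Import structures.
From mathcomp Require Import all_boot all_order all_algebra.
From mathcomp Require Import all_classical all_reals all_analysis.
From mathcomp Require Import measurable_realfun.
From mathcomp Require Import ring lra zify.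

Import Order.TTheory GRing.Theory Num.Theory.
Import numFieldNormedType.Exports.

Set Implicit Arguments.
Unset Strict Implicit.
Unset Printing Implicit Defensive.

Local Open Scope classical_set_scope.
Local Open Scope ring_scope.

(** Write [L = ln n] and [s = L^(1/alpha)], the size of the largest of the
    about [d n / 2] weights carried by edges.

    Lower bound.  The largest eigenvalue is at least every entry of the matrix
    ([entry_le_lambda1]), and some edge has weight at least [(1 - e) s]: the
    expected number of such edges is a positive power of [n], and they occur
    independently ([lower_tail]).

    Upper bound.  Edges are split according to whether the integer part of
    [|Y|^alpha] reaches a threshold [l0] of order [L^g], for a small [g > 0].

    The light edges form a matrix whose entries are at most [l0^(1/alpha)]
    times those of the adjacency matrix.  The square of the norm of the latter
    is at most the largest number of walks of length two from a vertex
    ([qform_bounded_entries]), which is at most [2 L] with high probability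
    ([two_walks_tail]).  As [alpha < 2], [g] can be chosen so that
    [L^(g/alpha) L^(1/2)] is negligible compared with [s].

    The heavy edges form a graph so sparse that it contains no triangle
    ([heavy_triangle_tail]) and that its components have [o(L / ln L)] edges.
    There are therefore only [n^(1 + o(1))] choices for the shape of a
    component, for its position and for the integer parts of the [|Y|^alpha]
    along its edges, while a given choice with sum at least [rho L] has
    probability about [n^(- rho)].  So, with high probability, every component
    has a sum of [|Y|^alpha] of at most [(1 + o(1)) L] ([heavy_cluster_tail]).
    In a triangle-free graph the largest eigenvalue is at most the square root
    of the sum of the squared edge weights ([eigenvalue_le_closed], which rests
    on a weighted form of Mantel's theorem, [triangle_free_weight]).  For
    [alpha < 2], a constraint on the sum of the [|Y|^alpha] leaves the sum of
    the squares largest when a single edge carries everything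
    ([sum_powR_le]), so this square root is at most [(1 + o(1)) s].

    The probability of a set that is not measurable is unspecified, hence the
    event of a deviation has to be shown measurable; this is
    [measurable_lambda1]. *)

(** * The largest eigenvalue as a Rayleigh quotient *)

Definition qform (R : realType) n (M : 'M[R]_n) (x : 'rV[R]_n) : R :=
  (x *m M *m x^T) 0 0.

Definition sqnorm (R : realType) n (x : 'rV[R]_n) : R := (x *m x^T) 0 0.

Section Rayleigh.
Context {R : realType} {n : nat}.
Implicit Types (M : 'M[R]_n) (x y : 'rV[R]_n).

Lemma qformE M x :
  qform M x = \sum_i \sum_j M i j * x 0 i * x 0 j.
Proof.
rewrite /qform mxE exchange_big /=; apply: eq_bigr => j _.
rewrite !mxE mulr_suml; apply: eq_bigr => i _; ring.
Qed.

Lemma sqnormE x : sqnorm x = \sum_i x 0 i ^+ 2.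
Proof. by rewrite /sqnorm mxE; apply: eq_bigr => i _; rewrite mxE expr2. Qed.

Lemma sqnorm_ge0 x : 0 <= sqnorm x.
Proof. by rewrite sqnormE; apply: sumr_ge0 => i _; exact: sqr_ge0. Qed.

Lemma sqnorm_gt0 x : x != 0 -> 0 < sqnorm x.
Proof.
move=> x0; rewrite lt_neqAle sqnorm_ge0 andbT eq_sym.
apply: contra x0 => /eqP; rewrite sqnormE => h.
apply/eqP/rowP => i; rewrite mxE.
have := psumr_eq0P (fun i _ => sqr_ge0 (x 0 i)) h.
by move=> /(_ i isT) /eqP; rewrite sqrf_eq0 => /eqP.
Qed.

Lemma sqr_le_sqnorm x i : x 0 i ^+ 2 <= sqnorm x.
Proof.
rewrite sqnormE (bigD1 i) //= lerDl.
by apply: sumr_ge0 => j _; exact: sqr_ge0.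
Qed.

Lemma qform_le M x :
  qform M x <= (\sum_i \sum_j `|M i j|) * sqnorm x.
Proof.
rewrite qformE mulr_suml; apply: ler_sum => i _.
rewrite mulr_suml; apply: ler_sum => j _.
rewrite -mulrA; apply: (le_trans (ler_norm _)); rewrite normrM.
apply: ler_wpM2l => //; rewrite ler_norml.
have := sqr_le_sqnorm x i; have := sqr_le_sqnorm x j.
move: (x 0 i) (x 0 j) => a b.
have := sqr_ge0 (a - b); have := sqr_ge0 (a + b).
by move=> ? ? ? ?; apply/andP; split; nra.
Qed.

Lemma qformZ M (c : R) x : qform M (c *: x) = c ^+ 2 * qform M x.
Proof. by rewrite /qform -!scalemxAl linearZ /= -scalemxAr !mxE mulrA expr2. Qed.

Lemma sqnormZ (c : R) x : sqnorm (c *: x) = c ^+ 2 * sqnorm x.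
Proof. by rewrite /sqnorm -!scalemxAl linearZ /= -scalemxAr !mxE mulrA expr2. Qed.

Lemma qform_scalar_sub M (s : R) x :
  qform (s%:M - M) x = s * sqnorm x - qform M x.
Proof.
by rewrite /qform /sqnorm mulmxBr mulmxBl mul_mx_scalar -scalemxAl !mxE.
Qed.

Lemma qform_sym M x y : M^T = M -> (x *m M *m y^T) 0 0 = (y *m M *m x^T) 0 0.
Proof.
move=> sM; rewrite -[in LHS](trmxK (x *m M *m y^T)) mxE.
by rewrite !trmx_mul trmxK sM mulmxA.
Qed.

(** If [A] is symmetric positive semidefinite and invertible, then testing
    positivity at [x - t x A^-1], for a suitable small [t], bounds [qform A x]
    away from [0] on the unit sphere. *)
Lemma psd_unit_coercive (A : 'M[R]_n) : A^T = A -> A \in unitmx ->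
  (forall x, 0 <= qform A x) ->
  exists2 c : R, 0 < c & forall x, c * sqnorm x <= qform A x.
Proof.
move=> sA uA psd.
pose k : R := 1 + \sum_i \sum_j `|invmx A i j|.
have k0 : 0 < k.
  by rewrite ltr_pwDl // sumr_ge0 // => i _; rewrite sumr_ge0.
exists k^-1; first by rewrite invr_gt0.
move=> x; pose w := x *m invmx A.
have wA : w *m A = x by rewrite /w mulmxKV.
have e1 : (x *m A *m w^T) 0 0 = sqnorm x.
  by rewrite (qform_sym _ _ sA) wA.
have e2 : qform A w = qform (invmx A) x.
  rewrite /qform wA /w trmx_mul mulmxA.
  have -> : (invmx A)^T = invmx A by rewrite trmx_inv sA.
  by [].
have e3 : qform (invmx A) x <= k * sqnorm x.
  apply: (le_trans (qform_le _ _)); apply: ler_wpM2r; first exact: sqnorm_ge0.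
  by rewrite lerDr.
have := psd (x - k^-1 *: w).
have -> : qform A (x - k^-1 *: w)
    = qform A x - k^-1 * sqnorm x *+ 2 + k^-1 ^+ 2 * qform A w.
  have := e1; have := e1; rewrite {1}(qform_sym _ _ sA) /qform.
  rewrite -scaleNr linearD /= linearZ /= !mulmxDl !mulmxDr.
  rewrite -!scalemxAl -!scalemxAr.
  move: (w *m A *m x^T) (x *m A *m w^T) (x *m A *m x^T) (w *m A *m w^T).
  by move=> a b c e; rewrite !mxE => -> ->; rewrite mulr2n; ring.
rewrite e2 => h.
have h2 : k^-1 ^+ 2 * qform (invmx A) x <= k^-1 * sqnorm x.
  have -> : k^-1 * sqnorm x = k^-1 ^+ 2 * (k * sqnorm x).
    by field; rewrite gt_eqF.
  by apply: ler_wpM2l => //; exact: sqr_ge0.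
move: h; rewrite mulr2n; lra.
Qed.

(** The supremum [s] of the Rayleigh quotient is an eigenvalue, since
    otherwise [s - M] would be invertible, hence coercive, and the quotient
    would stay below some [s - c]. *)
Lemma lambda1_spec M : M^T = M -> (0 < n)%N ->
  eigenvalue M (lambda1 M) /\ forall x, qform M x <= lambda1 M * sqnorm x.
Proof.
move=> sM n0.
pose S := [set qform M x | x in [set x | sqnorm x = 1]].
have supS : has_sup S.
  split.
    pose x : 'rV[R]_n := delta_mx 0 (Ordinal n0).
    exists (qform M x); exists x => //=.
    rewrite sqnormE (bigD1 (Ordinal n0)) //= big1 ?mxE ?eqxx ?addr0 ?expr1n //.
    by move=> i /negPf i0; rewrite mxE eqxx i0 expr0n.
  exists (\sum_i \sum_j `|M i j|) => _ [x /= x1 <-].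
  by have := qform_le M x; rewrite x1 mulr1.
set s := sup S.
have sP x : qform M x <= s * sqnorm x.
  have [->|x0] := eqVneq x 0.
    by rewrite /qform /sqnorm !mul0mx !mxE mulr0.
  have xp := sqnorm_gt0 x0.
  have c0 : (Num.sqrt (sqnorm x))^-1 ^+ 2 * sqnorm x = 1.
    by rewrite exprVn sqr_sqrtr ?sqnorm_ge0 // mulVf // gt_eqF.
  have : S (qform M ((Num.sqrt (sqnorm x))^-1 *: x)).
    by exists ((Num.sqrt (sqnorm x))^-1 *: x) => //=; rewrite sqnormZ.
  move=> /(sup_upper_bound supS); rewrite -/s qformZ exprVn sqr_sqrtr ?sqnorm_ge0 //.
  by rewrite ler_pdivrMl // mulrC.
have eig_le a : eigenvalue M a -> a <= s.
  move=> /eigenvalueP[v va v0]; have vp := sqnorm_gt0 v0.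
  have := sP v; rewrite /qform va -scalemxAl mxE -/(sqnorm v).
  by rewrite ler_pM2r.
have seig : eigenvalue M s.
  apply: contrapT => /negP ns.
  have uA : s%:M - M \in unitmx.
    move: ns; rewrite /eigenvalue /eigenspace negbK kermx_eq0 => f.
    rewrite -row_free_unit.
    have -> : s%:M - M = - (M - s%:M) by rewrite opprB.
    by rewrite /row_free mxrank_opp.
  have sA : (s%:M - M)^T = s%:M - M by rewrite linearB /= tr_scalar_mx sM.
  have [|c c0 hc] := psd_unit_coercive sA uA.
    by move=> x; rewrite qform_scalar_sub subr_ge0.
  have : s <= s - c.
    apply: ge_sup; first by case: supS.
    move=> _ [x /= x1 <-]; have := hc x.
    by rewrite qform_scalar_sub x1 !mulr1; lra.
  lra.
have -> : lambda1 M = s.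
  apply/eqP; rewrite eq_le; apply/andP; split.
    by apply: ge_sup; [exists s|exact: eig_le].
  by apply: ub_le_sup => //; exists s => a; exact: eig_le.
by [].
Qed.

Lemma qform_le_lambda1 M x : M^T = M -> (0 < n)%N ->
  qform M x <= lambda1 M * sqnorm x.
Proof. by move=> sM n0; have [_] := lambda1_spec sM n0. Qed.

Lemma lambda1_eigen M : M^T = M -> (0 < n)%N -> eigenvalue M (lambda1 M).
Proof. by move=> sM n0; have [] := lambda1_spec sM n0. Qed.

Lemma lambda1_le M (t : R) : M^T = M -> (0 < n)%N ->
  (forall x, qform M x <= t * sqnorm x) -> lambda1 M <= t.
Proof.
move=> sM n0 h; have /eigenvalueP[v va v0] := lambda1_eigen sM n0.
have vp := sqnorm_gt0 v0; have := h v.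
by rewrite /qform va -scalemxAl mxE -/(sqnorm v) ler_pM2r.
Qed.

(** The vector [e_i + e_j] has Rayleigh quotient [M i j]. *)
Lemma entry_le_lambda1 M i j : M^T = M -> (forall i, M i i = 0) ->
  i != j -> M i j <= lambda1 M.
Proof.
move=> sM d0 ij.
have n0 : (0 < n)%N by apply: leq_ltn_trans (ltn_ord i).
have := qform_le_lambda1 (delta_mx 0 i + delta_mx 0 j) sM n0.
rewrite qformE sqnormE.
have Mji : M j i = M i j by rewrite -[in LHS]sM mxE.
have ji : (j == i) = false by rewrite eq_sym (negPf ij).
pose D k : R := (k == i)%:R + (k == j)%:R.
have DE k : (delta_mx 0 i + delta_mx 0 j : 'rV[R]_n) 0 k = D k.
  by rewrite !mxE !eqxx.
have DS (F : 'I_n -> R) : \sum_k F k * D k = F i + F j.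
  rewrite (bigD1 i) //= (bigD1 j) ?ji //= /D !eqxx ji (negPf ij) big1.
    by rewrite !mulr1n !mulr0n addr0 add0r !mulr1 addr0.
  by move=> k /andP[/negPf -> /negPf ->]; rewrite addr0 mulr0.
under eq_bigr => k _.
  under eq_bigr => l _ do rewrite !DE.
  rewrite DS -mulrDl.
  over.
rewrite DS !d0 Mji.
under eq_bigr => k _ do rewrite DE expr2.
by rewrite DS /D !eqxx ji (negPf ij) /=; lra.
Qed.

End Rayleigh.

(** * Measurability of the largest eigenvalue *)

Section MeasurableLambda1.
Context {R : realType} {n : nat}.

Definition int_row (z : 'rV[int]_n) : 'rV[R]_n := map_mx intr z.

Lemma cvg_floor_scaled (a : R) :
  (Num.floor (k.+1%:R * a))%:~R / k.+1%:R @[k --> \oo] --> a.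
Proof.
have h0 : a - k.+1%:R^-1 @[k --> \oo] --> a.
  rewrite -[X in _ --> X]subr0; apply: cvgB; first exact: cvg_cst.
  exact: cvg_harmonic.
apply: (squeeze_cvgr _ h0 (cvg_cst a)).
apply: nearW => k; have k0 : 0 < k.+1%:R :> R by [].
have /andP[h1 h2] := floor_itv (k.+1%:R * a).
rewrite ler_pdivrMr // [a * _]mulrC h1 andbT ler_pdivlMr //.
rewrite mulrBl mulVf ?gt_eqF // lerBlDr mulrC.
by rewrite intrD in h2; exact: ltW.
Qed.

Lemma cvg_sum_fin (I : finType) (u : I -> nat -> R) (l : I -> R) :
  (forall i, u i k @[k --> \oo] --> l i) ->
  \sum_i u i k @[k --> \oo] --> \sum_i l i.
Proof.
by move=> ul; apply: cvg_big => [|i _]; [exact: add_continuous|exact: ul].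
Qed.

(** Rational directions suffice to test [M <= t], and by homogeneity so do
    integer ones. *)
Lemma lambda1_le_int (M : 'M[R]_n) (t : R) : M^T = M -> (0 < n)%N ->
  lambda1 M <= t <-> forall z : 'rV[int]_n,
    qform M (int_row z) <= t * sqnorm (int_row z).
Proof.
move=> sM n0; split=> [h z|h].
  apply: (le_trans (qform_le_lambda1 _ sM n0)).
  by apply: ler_wpM2r => //; exact: sqnorm_ge0.
apply: lambda1_le => // x.
pose z (k : nat) : 'rV[int]_n := \row_i Num.floor (k.+1%:R * x 0 i).
pose y (k : nat) : 'rV[R]_n := k.+1%:R^-1 *: int_row (z k).
have yx i : y k 0 i @[k --> \oo] --> x 0 i.
  rewrite (_ : (fun k => y k 0 i) =
    (fun k => (Num.floor (k.+1%:R * x 0 i))%:~R / k.+1%:R)).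
    exact: cvg_floor_scaled.
  by apply/funext => k; rewrite !mxE mulrC.
have hq : qform M (y k) @[k --> \oo] --> qform M x.
  rewrite qformE; under eq_fun do rewrite qformE.
  apply: cvg_sum_fin => i; apply: cvg_sum_fin => j.
  by apply: cvgM => //; apply: cvgM => //; exact: cvg_cst.
have hn : t * sqnorm (y k) @[k --> \oo] --> t * sqnorm x.
  apply: cvgM; first exact: cvg_cst.
  rewrite sqnormE; under eq_fun do rewrite sqnormE.
  by apply: cvg_sum_fin => i; apply: cvgM.
apply: (ler_cvg_to hq hn); apply: nearW => k.
rewrite qformZ sqnormZ mulrCA; apply: ler_wpM2l; [exact: sqr_ge0|exact: h].
Qed.

Lemma measurable_lambda1 (d : measure_display) (T : measurableType d)
    (M : T -> 'M[R]_n) : (0 < n)%N -> (forall w, (M w)^T = M w) ->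
  (forall i j, measurable_fun setT (fun w => M w i j)) ->
  measurable_fun setT (fun w => lambda1 (M w)).
Proof.
move=> n0 sM mM mD; apply: (measurability _ (RGenOInfty.measurableE R)) => //.
move=> _ [_ [t ->] <-]; rewrite setTI.
rewrite (_ : _ @^-1` _ = \bigcup_(z : 'rV[int]_n)
   ~` [set w | qform (M w) (int_row z) <= t * sqnorm (int_row z)]).
  apply: countable_bigcupT_measurable => [|z]; first exact: countableP.
  apply: measurableC; rewrite -[X in measurable X]setTI.
  have mq : measurable_fun setT (fun w => qform (M w) (int_row z)).
    under eq_fun do rewrite qformE.
    apply: measurable_sum => i; apply: measurable_sum => j.
    by apply: measurable_funM => //; apply: measurable_funM.
  by apply: measurable_fun_le => //; exact: measurable_cst.
rewrite -setC_bigcap; apply/seteqP; split=> w /=; rewrite in_itv /= andbT.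
  move=> lt h; move: lt; rewrite ltNge => /negP; apply.
  by apply/(lambda1_le_int _ (sM w) n0) => z; exact: h.
move=> h; rewrite ltNge; apply/negP => /(lambda1_le_int _ (sM w) n0) h'.
by apply: h => z _; exact: h'.
Qed.

End MeasurableLambda1.

(** * Deterministic bounds on quadratic forms of weighted graphs *)

Section GraphForms.
Context {R : realType} {n : nat}.

(** Schur's test, applied to the square of the adjacency matrix of [g]: its row
    sums are the numbers of walks of length two. *)
Lemma qform_bounded_entries (g : rel 'I_n) (S : 'M[R]_n) (tau W : R)
    (x : 'rV[R]_n) :
  symmetric g -> 0 <= tau -> 0 < W ->
  (forall i j, `|S i j| <= tau * (g i j)%:R) ->
  (forall i, \sum_j \sum_k ((g i j)%:R * (g j k)%:R) <= W) ->
  qform S x <= tau * Num.sqrt W * sqnorm x.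
Proof.
move=> sg tau0 W0 hS hW.
pose a i := `|x 0 i|.
have a2 i : a i ^+ 2 = x 0 i ^+ 2 by rewrite /a real_normK ?num_real.
pose b i := \sum_j (g i j)%:R * a j.
have nE : sqnorm x = \sum_i a i ^+ 2.
  by rewrite sqnormE; apply: eq_bigr => i _; rewrite a2.
have h1 : qform S x <= tau * \sum_i a i * b i.
  rewrite qformE mulr_sumr; apply: ler_sum => i _.
  rewrite /b mulrA mulr_sumr; apply: ler_sum => j _.
  apply: (le_trans (ler_norm _)); rewrite !normrM -/(a i) -/(a j).
  have := hS i j; have : 0 <= a i by rewrite /a.
  have : 0 <= a j by rewrite /a.
  move: (a i) (a j) `|S i j| ((g i j)%:R : R) => u v s c v0 u0 sc.
  have -> : tau * u * (c * v) = (tau * c) * u * v by ring.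
  by do 2 apply: ler_wpM2r => //.
have h2 : \sum_i b i ^+ 2 <= W * sqnorm x.
  have e1 i : b i ^+ 2 <= \sum_j \sum_k (g i j)%:R * (g i k)%:R * a j ^+ 2.
    have -> : b i ^+ 2 = \sum_j \sum_k (g i j)%:R * (g i k)%:R * (a j * a k).
      rewrite expr2 /b mulr_suml; apply: eq_bigr => j _.
      by rewrite mulr_sumr; apply: eq_bigr => k _; ring.
    rewrite -(@ler_pM2l _ 2) // ![2 * _]mulr_natl ![_ *+ 2]mulr2n.
    rewrite [X in _ <= _ + X]exchange_big /= -!big_split /=.
    apply: ler_sum => j _; rewrite -!big_split /=; apply: ler_sum => k _.
    have g0 (l m : 'I_n) : 0 <= (g l m)%:R :> R by [].
    have -> : (g i k)%:R * (g i j)%:R * a k ^+ 2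
       = (g i j)%:R * (g i k)%:R * a k ^+ 2 by ring.
    rewrite -!mulrDr; apply: ler_wpM2l; first by rewrite mulr_ge0.
    by have := sqr_ge0 (a j - a k); nra.
  apply: (le_trans (ler_sum _ (fun i _ => e1 i))).
  rewrite nE mulr_sumr exchange_big /=; apply: ler_sum => j _.
  apply: le_trans (_ : (\sum_i \sum_k ((g j i)%:R * (g i k)%:R)) * a j ^+ 2 <= _).
    rewrite mulr_suml; apply: ler_sum => i _; rewrite mulr_suml.
    by apply: ler_sum => k _; rewrite (sg j i).
  by apply: ler_wpM2r; [exact: sqr_ge0 | exact: hW].
have s0 : 0 < Num.sqrt W by rewrite sqrtr_gt0.
have sW : Num.sqrt W ^+ 2 = W by rewrite sqr_sqrtr // ltW.
have h3 : \sum_i a i * b i <= Num.sqrt W * sqnorm x.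
  have e2 : 2 * Num.sqrt W * (\sum_i a i * b i)
      <= W * sqnorm x + \sum_i b i ^+ 2.
    rewrite nE !mulr_sumr -big_split /=; apply: ler_sum => i _.
    have := sqr_ge0 (Num.sqrt W * a i - b i).
    by rewrite sqrrB exprMn sW mulr2n; nra.
  rewrite -(ler_pM2l s0) mulrA -expr2 sW; lra.
apply: (le_trans h1); rewrite -mulrA; exact: ler_wpM2l.
Qed.

(** Mantel's argument, with weights: the two ends of an edge have disjoint
    neighbourhoods, hence neighbourhoods of total weight at most [\sum x]. *)
Lemma triangle_free_weight (g : rel 'I_n) (x : 'I_n -> R) :
  symmetric g -> (forall i j k, g i j -> g i k -> ~~ g j k) ->
  (forall i, 0 <= x i) ->
  \sum_i \sum_j (g i j)%:R * x i * x j <= (\sum_i x i) ^+ 2 / 2.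
Proof.
move=> sg tf x0.
pose s i := \sum_j (g i j)%:R * x j.
set X := \sum_i x i; set Q := \sum_i _.
have QE : Q = \sum_i x i * s i.
  apply: eq_bigr => i _; rewrite /s mulr_sumr; apply: eq_bigr => j _; ring.
have X0 : 0 <= X by apply: sumr_ge0.
have [X1|X1] := eqVneq X 0.
  have xi0 i : x i = 0 by apply: (psumr_eq0P (fun i _ => x0 i) X1).
  rewrite /Q X1 expr0n mul0r big1 // => i _.
  by rewrite big1 // => j _; rewrite !xi0 mulr0.
have {X1} Xp : 0 < X by rewrite lt_neqAle eq_sym X1.
have se i j : g i j -> s i + s j <= X.
  move=> gij; rewrite /s -big_split /=; apply: ler_sum => k _.
  rewrite -mulrDl ler_piMl //.
  have [gik|] := boolP (g i k); last by rewrite add0r lern1 leq_b1.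
  by rewrite (negPf (tf _ _ _ gij gik)) addr0.
have h1 : 2 * \sum_i x i * s i ^+ 2 <= X * Q.
  have e : \sum_i x i * s i ^+ 2 = \sum_i \sum_j (g i j)%:R * x i * x j * s i.
    apply: eq_bigr => i _.
    by rewrite expr2 mulrA -mulr_suml; congr (_ * _); rewrite /s mulr_sumr;
      apply: eq_bigr => j _; ring.
  rewrite mulr_natl mulr2n {2}e exchange_big /= e -big_split /= /Q mulr_sumr.
  apply: ler_sum => i _; rewrite -big_split mulr_sumr /=; apply: ler_sum => j _.
  rewrite (sg j i); case: (boolP (g i j)) => [gij|_]; last first.
    by rewrite !mul0r addr0 mulr0.
  have := se _ _ gij; have := mulr_ge0 (x0 i) (x0 j).
  move: (x i) (x j) (s i) (s j) => u v p q uv pq.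
  have -> : 1 * u * v * p + 1 * v * u * q = (u * v) * (p + q) by ring.
  have -> : X * (1 * u * v) = (u * v) * X by ring.
  exact: ler_wpM2l.
have h2 : 0 <= \sum_i x i * (s i - X / 2) ^+ 2.
  by apply: sumr_ge0 => i _; rewrite mulr_ge0 // sqr_ge0.
have h3 : \sum_i x i * (s i - X / 2) ^+ 2
    = \sum_i x i * s i ^+ 2 - X * Q + X ^+ 2 / 4 * X.
  have -> : X ^+ 2 / 4 * X = \sum_i X ^+ 2 / 4 * x i by rewrite -mulr_sumr.
  rewrite QE mulr_sumr -sumrB -big_split /=.
  by apply: eq_bigr => i _; field.
rewrite -(ler_pM2l Xp); lra.
Qed.

(** The restriction [y] of the eigenvector [u] to the closed set [D] is again
    an eigenvector.  Pair the entries of [M] on [D] with the products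
    [y i * y j] over the edges, by the Cauchy-Schwarz inequality: the squares
    of these products sum to at most [(\sum_i y i ^+ 2) ^+ 2 / 2], the graph
    being triangle-free. *)
Lemma eigenvalue_le_closed (g : rel 'I_n) (M : 'M[R]_n) (D : {set 'I_n})
    (v : 'I_n) (u : 'rV[R]_n) (a f : R) :
  symmetric g -> (forall i j k, g i j -> g i k -> ~~ g j k) ->
  M^T = M -> (forall i j, M i j != 0 -> g i j) ->
  (forall i j, i \in D -> g i j -> j \in D) ->
  u *m M = a *: u -> v \in D -> u 0 v != 0 -> 0 < f ->
  \sum_(i in D) \sum_(j in D) M i j ^+ 2 <= 2 * f ^+ 2 -> a <= f.
Proof.
move=> sg tf sM Mg cD ua vD uv f0 hF.
pose y i : R := if i \in D then u 0 i else 0.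
pose N := \sum_i y i ^+ 2.
have N0 : 0 < N.
  rewrite /N (bigD1 v) //= ltr_pwDl //; last first.
    by apply: sumr_ge0 => i _; exact: sqr_ge0.
  by rewrite /y vD lt_neqAle sqr_ge0 andbT eq_sym sqrf_eq0.
have Me i j : M i j = M j i by rewrite -[in RHS]sM mxE.
have aN : a * N = \sum_i \sum_j M i j * (y i * y j).
  rewrite /N mulr_sumr; apply: eq_bigr => i _.
  rewrite /y; case: ifP => iD; last first.
    by rewrite big1 ?expr0n ?mulr0 // => j _; rewrite mul0r mulr0.
  have := congr1 (fun m : 'rV_n => m 0 i) ua; rewrite !mxE => e.
  rewrite expr2 mulrA -e mulr_suml; apply: eq_bigr => j _.
  case: ifP => jD; first by rewrite (Me i j); ring.
  rewrite mulr0 mulr0 (_ : M j i = 0) ?mulr0 ?mul0r //.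
  apply: contrapT => /eqP; rewrite Me => /Mg /(cD _ _ iD).
  by rewrite jD.
have tfw : \sum_i \sum_j (g i j)%:R * y i ^+ 2 * y j ^+ 2 <= N ^+ 2 / 2.
  by apply: triangle_free_weight => // i; exact: sqr_ge0.
have FD : \sum_i \sum_j ((i \in D) && (j \in D))%:R * M i j ^+ 2 <= 2 * f ^+ 2.
  apply: le_trans hF; rewrite [X in _ <= X]big_mkcond /=.
  apply: ler_sum => i _; case: (i \in D) => /=; last first.
    by rewrite big1 // => j _; rewrite mul0r.
  rewrite [X in _ <= X]big_mkcond /=; apply: ler_sum => j _.
  by case: (j \in D); rewrite ?mul1r ?mul0r.
(* Cauchy-Schwarz, as the inequality of arithmetic and geometric means with
   the factor that balances the two sums. *)
have key : 2 * (a * N) <= (N / (2 * f)) * (2 * f ^+ 2) + (2 * f / N) * (N ^+ 2 / 2).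
  have c1 : 0 < N / (2 * f) by rewrite divr_gt0 // mulr_gt0.
  have c2 : 0 < 2 * f / N by rewrite divr_gt0 // mulr_gt0.
  have c12 : N / (2 * f) * (2 * f / N) = 1 by field; rewrite !gt_eqF.
  apply: le_trans (_ : _ <= (N / (2 * f)) *
     (\sum_i \sum_j ((i \in D) && (j \in D))%:R * M i j ^+ 2) +
     (2 * f / N) * (\sum_i \sum_j (g i j)%:R * y i ^+ 2 * y j ^+ 2)) _; last first.
    by apply: lerD; apply: ler_wpM2l => //; exact: ltW.
  move: (N / (2 * f)) (2 * f / N) c1 c2 c12 => c c' c1 c2 c12.
  rewrite aN !mulr_sumr -big_split /=; apply: ler_sum => i _.
  rewrite !mulr_sumr -big_split /=; apply: ler_sum => j _.
  rewrite /y; case: ifP => iD; last first.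
    by rewrite !(mul0r, mulr0, expr0n) /= !(mul0r, mulr0, addr0).
  case: ifP => jD; last first.
    by rewrite !(mul0r, mulr0, expr0n) /= !(mul0r, mulr0, addr0).
  have [->|M0] := eqVneq (M i j) 0.
    rewrite mul0r mulr0; apply: addr_ge0; apply: mulr_ge0.
    - exact: ltW.
    - exact: mulr_ge0.
    - exact: ltW.
    - by apply: mulr_ge0; [apply: mulr_ge0 => //|]; exact: sqr_ge0.
  rewrite (Mg _ _ M0) /= !mul1r.
  move: (M i j) (u 0 i) (u 0 j) => m p q.
  have := sqr_ge0 (c * m - p * q).
  have -> : (c * m - p * q) ^+ 2
     = c * (c * m ^+ 2 + c' * (p ^+ 2 * q ^+ 2) - 2 * (m * (p * q)))
       + (1 - c * c') * (p ^+ 2 * q ^+ 2) by ring.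
  by rewrite c12 subrr mul0r addr0 pmulr_rge0 // subr_ge0.
have e1 : (N / (2 * f)) * (2 * f ^+ 2) + (2 * f / N) * (N ^+ 2 / 2) = 2 * (f * N).
  by field; rewrite !gt_eqF.
by rewrite e1 ler_pM2l // ler_pM2r in key.
Qed.

End GraphForms.

(** * Clusters of edges *)

Section Clusters.
Context {n : nat}.
Local Notation I := ('I_n * 'I_n)%type.
Implicit Types (i j v : 'I_n) (e : I) (J live : {set I}).

(** An unordered pair of vertices is represented by its increasing ordering,
    so as to index the independent variables. *)
Definition edge i j : I := if (i < j)%N then (i, j) else (j, i).

Lemma edgeC i j : edge i j = edge j i.
Proof.
by rewrite /edge; case: ltngtP => // h; rewrite (ord_inj h).
Qed.

Lemma edge_upper i j : i != j -> edge i j \in @upper_pair n.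
Proof.
by rewrite /edge inE neq_ltn => /orP[]; case: ltngtP.
Qed.

Lemma edge_id e : e \in @upper_pair n -> edge e.1 e.2 = e.
Proof. by rewrite inE /edge; case: e => a b /= ->. Qed.

Definition reached v J : {set 'I_n} :=
  v |: ((fst @: J) :|: (snd @: J))%SET.

Lemma reached1 v J e : e \in J -> e.1 \in reached v J.
Proof. by move=> eJ; rewrite !inE (imset_f fst eJ) /= orbT. Qed.

Lemma reached2 v J e : e \in J -> e.2 \in reached v J.
Proof. by move=> eJ; rewrite !inE (imset_f snd eJ) /= !orbT. Qed.

Lemma card_reached v J : (#|reached v J| <= (2 * #|J|).+1)%N.
Proof.
rewrite /reached cardsU1 -add1n leq_add ?leq_b1 //.
apply: (leq_trans (leq_card_setU _ _)).
by rewrite mul2n -addnn leq_add // leq_imset_card.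
Qed.

Definition frontier v J : {set I} :=
  [set e in @upper_pair n |
    (e \notin J) && ((e.1 \in reached v J) || (e.2 \in reached v J))].

Lemma card_frontier v J : (#|frontier v J| <= (2 * #|J|).+1 * n)%N.
Proof.
have sub : frontier v J \subset
    ((fun q : I => edge q.1 q.2) @: finset.setX (reached v J) [set: 'I_n])%SET.
  apply/fintype.subsetP => e; rewrite inE => /and3P[eu _ /orP[h|h]].
    by apply/imsetP; exists e; rewrite ?edge_id // finset.inE h finset.in_setT.
  apply/imsetP; exists (e.2, e.1); rewrite /= 1?edgeC ?edge_id //.
  by rewrite finset.in_setX h finset.in_setT.
apply: (leq_trans (subset_leq_card sub)).
apply: (leq_trans (leq_imset_card _ _)).
by rewrite cardsX cardsT card_ord leq_mul2r card_reached orbT.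
Qed.

(** Connectedness is built in by growing the set from [v], which makes the sets
    easy to count: an edge is added by choosing one of the few vertices already
    reached and any of the [n] vertices. *)
Fixpoint clusters v k : {set {set I}} :=
  if k is k'.+1 then
    (\bigcup_(J in clusters v k') [set e |: J | e in frontier v J])%SET
  else [set finset.set0]%SET.

Lemma cluster_card v k J : J \in clusters v k -> #|J| = k.
Proof.
elim: k J => [|k IH] J /=; first by rewrite inE => /eqP ->; rewrite cards0.
move=> /finset.bigcupP[J' J'c /imsetP[e]]; rewrite inE => /and3P[_ eJ' _] ->.
by rewrite cardsU1 eJ' (IH _ J'c).
Qed.

Lemma cluster_upper v k J :
  J \in clusters v k -> {subset J <= @upper_pair n}.
Proof.
elim: k J => [|k IH] J /=.
  by rewrite inE => /eqP -> e; rewrite inE.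
move=> /finset.bigcupP[J' J'c /imsetP[e]]; rewrite inE => /and3P[eu _ _] ->.
by move=> e'; rewrite in_setU1 => /orP[/eqP ->//|]; exact: (IH _ J'c).
Qed.

Lemma card_clusters v k K : (k <= K)%N ->
  (#|clusters v k| <= ((2 * K).+1 * n) ^ k)%N.
Proof.
elim: k => [|k IH] kK; first by rewrite cards1 expn0.
rewrite expnSr /=.
set F := fun J : {set I} => ([set e |: J | e in frontier v J])%SET.
have bigU (A : {set {set I}}) : (#|(\bigcup_(J in A) F J)%SET| <= \sum_(J in A) #|F J|)%N.
  elim/big_rec2: _ => [|J m U _ h]; first by rewrite cards0.
  by apply: (leq_trans (leq_card_setU _ _)); rewrite leq_add2l.
apply: (leq_trans (bigU _)).
apply: (leq_trans (_ : _ <= \sum_(J in clusters v k) (2 * K).+1 * n)%N).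
  apply: leq_sum => J Jc; apply: (leq_trans (leq_imset_card _ _)).
  apply: (leq_trans (card_frontier _ _)); rewrite (cluster_card Jc).
  by rewrite leq_mul2r; apply/orP; right; lia.
by rewrite sum_nat_const leq_mul2r IH ?orbT //; lia.
Qed.

(** A largest live cluster grown from [v] absorbs every live edge that meets
    it: such an edge could otherwise be added to it. *)
Lemma closed_cluster live v K : {subset live <= @upper_pair n} ->
  (forall J, J \in clusters v K -> ~~ (J \subset live)) ->
  exists k J, [/\ (k < K)%N, J \in clusters v k, J \subset live &
    forall e, e \in live -> (e.1 \in reached v J) || (e.2 \in reached v J) ->
      e \in J].
Proof.
move=> lu; elim: K => [|K IH] hK.
  by have := hK finset.set0; rewrite inE eqxx finset.sub0set => /(_ isT).
have [/existsP[J /andP[Jc Jl]]|] :=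
    boolP [exists J, (J \in clusters v K) && (J \subset live)].
  exists K, J; split=> // e el et; apply: contraT => eJ.
  have : e |: J \in clusters v K.+1.
    apply/finset.bigcupP; exists J => //; apply/imsetP; exists e => //.
    by rewrite inE lu // eJ et.
  by move=> /hK; rewrite finset.subUset finset.sub1set el Jl.
rewrite negb_exists => /forallP h; have [|k [J [kK Jc Jl cl]]] := IH.
  by move=> J Jc; have := h J; rewrite Jc.
by exists k, J; split=> //; exact: ltnW.
Qed.

End Clusters.

Section SplitBound.
Context {R : realType} {n : nat}.
Local Notation I := ('I_n * 'I_n)%type.

Lemma sum_edges_le (B : 'I_n -> 'I_n -> R) (D : {set 'I_n}) (J : {set I})
    (c : I -> R) :
  (forall i, B i i = 0) -> (forall i j, B i j = B j i) ->
  (forall e, 0 <= c e) ->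
  (forall i j, i \in D -> j \in D -> (i < j)%N -> B i j != 0 ->
     (i, j) \in J /\ B i j <= c (i, j)) ->
  \sum_(i in D) \sum_(j in D) B i j <= 2 * \sum_(e in J) c e.
Proof.
move=> B0 Bs c0 h.
pose U (i j : 'I_n) := if (i < j)%N then B i j else 0.
have BU i j : B i j = U i j + U j i.
  rewrite /U; case: ltngtP => [||/ord_inj ->]; rewrite ?add0r ?addr0 ?B0 //.
have e1 : \sum_(i in D) \sum_(j in D) B i j
    = 2 * \sum_(i in D) \sum_(j in D) U i j.
  rewrite mulr_natl mulr2n [in X in _ = _ + X]exchange_big /= -big_split /=.
  apply: eq_bigr => i _; rewrite -big_split /=.
  by apply: eq_bigr => j _; exact: BU.
rewrite e1 ler_pM2l // pair_big /=.
rewrite big_mkcond [X in _ <= X]big_mkcond /=; apply: ler_sum => -[i j] _ /=.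
case: ifP => [/andP[iD jD]|_]; last by case: ifP.
rewrite /U; case: ltnP => ij; last by case: ifP.
have [->|Bn] := eqVneq (B i j) 0; first by case: ifP.
by have [-> ] := h _ _ iD jD ij Bn.
Qed.

(** The matrix is the sum of its live part, where an eigenvector can be
    restricted to a single closed cluster, and of a part with small entries. *)
Lemma lambda1_le_split (g : rel 'I_n) (M : 'M[R]_n) (live : {set I})
    (tau W f : R) :
  (0 < n)%N -> symmetric g -> M^T = M -> (forall i, M i i = 0) ->
  0 <= tau -> 0 < W -> 0 < f ->
  {subset live <= @upper_pair n} ->
  (forall i j, edge i j \notin live -> `|M i j| <= tau * (g i j)%:R) ->
  (forall i, \sum_j \sum_k ((g i j)%:R * (g j k)%:R) <= W) ->
  (forall i j k, edge i j \in live -> edge i k \in live ->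
     edge j k \notin live) ->
  (forall v, exists J : {set I}, [/\ J \subset live,
     \sum_(e in J) M e.1 e.2 ^+ 2 <= f ^+ 2 &
     forall e, e \in live -> (e.1 \in reached v J) || (e.2 \in reached v J) ->
      e \in J]) ->
  lambda1 M <= f + tau * Num.sqrt W.
Proof.
move=> n0 sg sM M0 tau0 W0 f0 lu hS hW htri hJ.
pose B := \matrix_(i, j) (if edge i j \in live then M i j else 0).
have Me i j : M i j = M j i by rewrite -[in RHS]sM mxE.
have BE i j : B i j = if edge i j \in live then M i j else 0 by rewrite mxE.
have sB : B^T = B by apply/matrixP => i j; rewrite mxE !BE edgeC Me.
have Bf : lambda1 B <= f.
  have /eigenvalueP[u uB u0] := lambda1_eigen sB n0.
  have [v uv] : exists v, u 0 v != 0.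
    apply: contrapT => hn; move/eqP: u0; apply; apply/rowP => i; rewrite mxE.
    by apply: contrapT => /eqP ui; apply: hn; exists i.
  have [J [Jl JF Jc]] := hJ v.
  have Dcl i j : i \in reached v J -> edge i j \in live -> edge i j \in J.
    move=> iD el; apply: Jc => //; move: iD; rewrite /edge.
    by case: ifP => _ /= ->; rewrite ?orbT.
  apply: (@eigenvalue_le_closed _ _ (fun i j => edge i j \in live) B
    (reached v J) v u) => //.
  - by move=> i j; rewrite edgeC.
  - by move=> i j; rewrite BE; case: ifP; rewrite // eqxx.
  - move=> i j iD el; have eJ := Dcl _ _ iD el.
    have := reached1 v eJ; have := reached2 v eJ; rewrite /edge.
    by case: ifP.
  - by rewrite !inE eqxx.
  - apply: (le_trans (@sum_edges_le (fun i j => B i j ^+ 2) _ J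
      (fun e => M e.1 e.2 ^+ 2) _ _ _ _)).
    + by move=> i; rewrite BE M0; case: ifP; rewrite expr0n.
    + by move=> i j; rewrite !BE edgeC Me.
    + by move=> e; exact: sqr_ge0.
    + move=> i j iD jD ij; rewrite BE; case: ifP; last by rewrite expr0n eqxx.
      by move=> /(Dcl _ _ iD); rewrite /edge ij.
    + by rewrite ler_pM2l.
apply: lambda1_le => // x.
have -> : qform M x = qform B x + qform (M - B) x.
  have {1}-> : M = B + (M - B) by rewrite addrC subrK.
  by rewrite /qform mulmxDr mulmxDl mxE.
rewrite mulrDl; apply: lerD.
  apply: le_trans (qform_le_lambda1 x sB n0) _.
  by apply: ler_wpM2r => //; exact: sqnorm_ge0.
apply: (@qform_bounded_entries _ _ g) => // i j.
have -> : (M - B) i j = M i j - B i j by rewrite !mxE.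
rewrite BE; case: (boolP (edge i j \in live)) => [_|/hS]; last by rewrite subr0.
by rewrite subrr normr0 mulr_ge0.
Qed.

End SplitBound.

(** * Independence of the edge variables *)

Lemma union_event (d : measure_display) (T : measurableType d) (R : realType)
    (P : probability T R) (I : finType) (D : {pred I})
    (B : I -> set T) (b : I -> R) :
  (forall i, i \in D -> measurable (B i)) ->
  (forall i, i \in D -> (P (B i) <= (b i)%:E)%E) ->
  measurable [set w | exists2 i, i \in D & B i w] /\
  (P [set w | exists2 i, i \in D & B i w] <= (\sum_(i in D) b i)%:E)%E.
Proof.
move=> mB hb.
have -> : [set w | exists2 i, i \in D & B i w] = \big[setU/set0]_(i in D) B i.
  by rewrite -bigcup_pred.
elim/big_rec2: _ => [|i s V iD [mV hV]]; first by rewrite measure0.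
split; first by apply: measurableU => //; exact: mB.
by rewrite (le_trans (measureU2 _ _ _)) ?EFinD ?leeD ?hb //; exact: mB.
Qed.

Lemma sigma_algebra_finI (T : Type) (G : set (set T)) (I : finType)
    (J : {pred I}) (A : I -> set T) :
  (forall i, i \in J -> <<s G >> (A i)) ->
  <<s G >> (\bigcap_(i in [set` J]) A i).
Proof.
move=> hA; have [s0 sC sU] := smallest_sigma_algebra setT G.
have sCC B : <<s G >> B -> <<s G >> (~` B) by rewrite -setTD; apply: sC.
have sI B C : <<s G >> B -> <<s G >> C -> <<s G >> (B `&` C).
  move=> hB hC; rewrite -(setCK (B `&` C)) setCI -bigcup2E.
  by apply: (sCC); apply: sU => -[|[|k]] //=; exact: sCC.
rewrite -[X in <<s G >> X]setCK setC_bigcap bigcup_pred.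
apply: (sCC); apply: big_ind => // [B C hB hC|i iJ]; last exact: sCC (hA i iJ).
by rewrite -(setCK (B `|` C)) setCU; apply: (sCC); apply: sI; exact: sCC.
Qed.

Section EdgeEvents.
Context (d : measure_display) (T : measurableType d) (R : realType)
  (P : probability T R) (n : nat) (p : R) (mu : probability R R)
  (G : T -> rel 'I_n) (Y : T -> 'M[R]_n).
Hypotheses (G_erdos_renyi : erdos_renyi P p G)
  (Y_iid : iid_symmetric_mx P mu Y)
  (XY_independent : independent P (sigma_mx (fun w => adjacency_mx R (G w)))
                                  (sigma_mx Y)).
Local Notation I := ('I_n * 'I_n)%type.

Definition edge_event (J : {set I}) (U : I -> set R) : set T :=
  [set w | forall e, e \in J -> G w e.1 e.2 /\ U e (Y w e.1 e.2)].

Lemma measurable_present (i j : 'I_n) : measurable [set w | G w i j].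
Proof.
have [Gs mG _] := G_erdos_renyi.
have sG w := (Gs w).1; have iG w := (Gs w).2.
have [ij|ji|/ord_inj ->] := ltngtP i j.
- by case: (mG _ _ ij).
- rewrite (_ : [set w | G w i j] = [set w | G w j i]).
    by case: (mG _ _ ji).
  by apply/seteqP; split=> w /=; rewrite sG.
- rewrite (_ : [set _ | _] = set0) //.
  by apply/seteqP; split=> w //=; rewrite iG.
Qed.

Lemma measurable_weight (i j : 'I_n) : measurable_fun setT (fun w => Y w i j).
Proof.
have [Y0 Ys Yl _] := Y_iid.
have [ij|ji|/ord_inj ->] := ltngtP i j.
- by case: (Yl _ _ ij).
- rewrite (_ : (fun w => Y w i j) = (fun w => Y w j i)).
    by case: (Yl _ _ ji).
  by apply/funext => w; rewrite Ys.
- rewrite (_ : (fun w => Y w j j) = cst 0) //.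
  by apply/funext => w; rewrite Y0.
Qed.

Lemma measurable_edge_event (J : {set I}) (U : I -> set R) : (forall e, measurable (U e)) ->
  measurable (edge_event J U).
Proof.
move=> mU.
rewrite (_ : edge_event J U = \bigcap_(e in [set` J])
   ([set w | G w e.1 e.2] `&` (fun w => Y w e.1 e.2) @^-1` U e)).
  apply: fin_bigcap_measurable => // e _; apply: measurableI.
    exact: measurable_present.
  by rewrite -[X in measurable X]setTI; apply: measurable_weight.
by apply/seteqP; split=> w /= h e /h.
Qed.

(** The graph and the weights are independent, and each is a family of
    independent variables, so that the pairs (edge, weight) are independent. *)
Lemma edge_event_prob (J : {set I}) (U : I -> set R) : {subset J <= @upper_pair n} ->
  (forall e, measurable (U e)) ->
  P (edge_event J U) = (\prod_(e in J) (p * fine (mu (U e))))%:E.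
Proof.
move=> Ju mU.
have [Gs mG Gi] := G_erdos_renyi.
have [Y0 Ys Yl Yi] := Y_iid.
pose A e := [set w | G w e.1 e.2].
pose B e := (fun w => Y w e.1 e.2) @^-1` U e.
have AE : edge_event J U
    = (\bigcap_(e in [set` J]) A e) `&` (\bigcap_(e in [set` J]) B e).
  apply/seteqP; split=> [w h|w [hA hB] e eJ].
    by split=> e /h [].
  by split; [exact: hA|exact: hB].
rewrite AE XY_independent; last 2 first.
- apply: sigma_algebra_finI => e _; apply: sub_sigma_algebra; exists e => //.
  exists [set 1] => //; rewrite setTI; apply/seteqP; split=> w /=.
    rewrite mxE /A /=; case: (G w e.1 e.2) => // h.
    by case/eqP: (@oner_neq0 R).
  by rewrite /A /= mxE => ->.
- apply: sigma_algebra_finI => e _; apply: sub_sigma_algebra; exists e => //.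
  by exists (U e) => //; rewrite setTI.
rewrite (Gi J A) //; last first.
  by move=> e _; exists [set true] => //; rewrite setTI.
rewrite (Yi J B) //; last first.
  by move=> e _; exists (U e) => //; rewrite setTI.
rewrite -prodEFin -big_split /=; apply: eq_bigr => e eJ.
have eu := Ju _ eJ; rewrite inE in eu.
rewrite EFinM /A (mG _ _ eu).2; congr (_ * _)%E.
by rewrite /B (Yl _ _ eu).2 // fineK // fin_num_measure.
Qed.

End EdgeEvents.

(** * The lower tail *)

Section Avoid.
Context (d : measure_display) (T : measurableType d) (R : realType)
  (P : probability T R) (I : finType) (D : {set I}) (E : I -> set T)
  (q : I -> R).
Hypothesis mE : forall i, measurable (E i).
Hypothesis E_indep : forall J : {set I}, J \subset D ->
  P [set w | forall i, i \in J -> E i w] = (\prod_(i in J) q i)%:E.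

Lemma measurable_all_none (K J : {set I}) :
  measurable [set w | (forall i, i \in K -> E i w) /\
                      (forall i, i \in J -> ~ E i w)].
Proof.
rewrite (_ : mkset _ = (\bigcap_(i in [set` K]) E i) `&`
                       (\bigcap_(i in [set` J]) ~` E i)) //.
apply: measurableI; apply: fin_bigcap_measurable => // i _.
exact: measurableC.
Qed.

(** Requiring the events of [K] makes an induction on [J] possible: for [x] in
    [J], the probability is the one for [K] and [J :\ x] minus the one for
    [x |: K] and [J :\ x]. *)
Lemma prob_all_none (K J : {set I}) : K \subset D -> J \subset D ->
  (forall i, i \in K -> i \notin J) ->
  P [set w | (forall i, i \in K -> E i w) /\ (forall i, i \in J -> ~ E i w)]
  = (\prod_(i in K) q i * \prod_(i in J) (1 - q i))%:E.
Proof.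
have [m] := ubnP #|J|; elim: m K J => // m IH K J Jm KD JD dKJ.
have [J0|/set0Pn[x xJ]] := eqVneq J finset.set0.
  rewrite J0 [X in _ * X]big_set0 mulr1 -E_indep //; congr (P _).
  by apply/seteqP; split=> w /= => [[]//|h]; split=> // i; rewrite inE.
pose J' := J :\ x.
have JE i : i \in J = (i == x) || (i \in J').
  by rewrite /J' !inE; case: eqVneq => // ->.
have xK : x \notin K.
  by apply: contraL xJ; exact: dKJ.
have J'm : (#|J'| < m)%N by move: Jm; rewrite /J' (cardsD1 x) xJ.
have J'D : J' \subset D by apply: fintype.subset_trans JD; exact: finset.subD1set.
have xKD : x |: K \subset D.
  by rewrite finset.subUset finset.sub1set (fintype.subsetP JD _ xJ).
have dK i : i \in K -> i \notin J'.
  by move=> /dKJ; apply: contra; rewrite JE => ->; rewrite orbT.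
have dxK i : i \in x |: K -> i \notin J'.
  by rewrite in_setU1 => /orP[/eqP ->|/dK//]; rewrite !inE eqxx.
have -> : [set w | (forall i, i \in K -> E i w) /\ (forall i, i \in J -> ~ E i w)]
  = [set w | (forall i, i \in K -> E i w) /\ (forall i, i \in J' -> ~ E i w)]
  `\` [set w | (forall i, i \in x |: K -> E i w) /\
               (forall i, i \in J' -> ~ E i w)].
  apply/seteqP; split=> w /=.
    move=> [hK hJ]; split.
      by split=> // i iJ; apply: hJ; rewrite JE iJ orbT.
    by move=> [h _]; apply: (hJ x xJ); apply: h; rewrite !inE eqxx.
  move=> [[hK hJ] hn]; split=> // i; rewrite JE => /orP[/eqP -> Ex|]; last exact: hJ.
  apply: hn; split=> // k; rewrite !inE => /orP[/eqP ->//|]; exact: hK.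
rewrite measureD; last 3 first.
- exact: measurable_all_none.
- exact: measurable_all_none.
- by rewrite ltey_eq fin_num_measure //; exact: measurable_all_none.
rewrite setIidr; last first.
  move=> w /= [h1 h2]; split=> // i iK; apply: h1; by rewrite !inE iK orbT.
have eK := IH K J' J'm KD J'D dK; have exK := IH _ J' J'm xKD J'D dxK.
apply: (etrans (congr2 (fun a b => a - b)%E eK exK)).
rewrite -EFinB; congr EFin.
by rewrite big_setU1 //= [\prod_(i in J) _](big_setD1 x) //=; ring.
Qed.

Lemma prob_none : P [set w | forall i, i \in D -> ~ E i w]
  = (\prod_(i in D) (1 - q i))%:E.
Proof.
have := @prob_all_none finset.set0 D; rewrite big_set0 mul1r => <- //.
- by congr (P _); apply/seteqP; split=> w /= => [h|[]//]; split=> // i; rewrite inE.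
- exact: finset.sub0set.
- by move=> i; rewrite inE.
Qed.

End Avoid.

Lemma card_upper_pair n :
  (2 * #|[set e in @upper_pair n]| + n = n * n)%N.
Proof.
pose L := [set e : 'I_n * 'I_n | (e.2 < e.1)%N]%SET.
pose Dg := [set e : 'I_n * 'I_n | e.1 == e.2]%SET.
set U := [set e in _]%SET.
have UL : #|L| = #|U|.
  rewrite -(card_imset U (_ : injective (fun e : 'I_n * 'I_n => (e.2, e.1)))).
    apply: eq_card => -[a b]; rewrite inE /=; apply/idP/imsetP => [h|].
      by exists (b, a) => //; rewrite !inE.
    by move=> [[a' b']]; rewrite !inE /= => h [-> ->].
  by move=> [a b] [a' b'] /= [-> ->].
have DN : #|Dg| = n.
  rewrite -[RHS]card_ord -(card_imset 'I_n (_ : injective (fun i => (i, i)))).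
    apply: eq_card => -[a b]; rewrite inE /=; apply/eqP/imsetP => [->|].
      by exists b.
    by move=> [c _ [-> ->]].
  by move=> a b [].
have : (#|[set: 'I_n * 'I_n]%SET| = #|U| + #|L| + #|Dg|)%N.
  have -> : [set: 'I_n * 'I_n]%SET = (U :|: L :|: Dg)%SET.
    apply/setP => -[a b]; rewrite !inE /= -val_eqE /=; by case: ltngtP.
  rewrite !cardsU.
  have -> : (U :&: L = finset.set0)%SET.
    by apply/setP => -[a b]; rewrite !inE /=; case: ltngtP.
  have -> : ((U :|: L) :&: Dg = finset.set0)%SET.
    by apply/setP => -[a b]; rewrite !inE /= -val_eqE /=; case: ltngtP.
  by rewrite !cards0 !subn0.
by rewrite cardsT card_prod card_ord UL DN => ->; lia.
Qed.

Section LowerTail.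
Context (d : measure_display) (T : measurableType d) (R : realType)
  (P : probability T R) (n : nat) (p : R) (mu : probability R R)
  (G : T -> rel 'I_n) (Y : T -> 'M[R]_n).
Hypotheses (G_erdos_renyi : erdos_renyi P p G)
  (Y_iid : iid_symmetric_mx P mu Y)
  (XY_independent : independent P (sigma_mx (fun w => adjacency_mx R (G w)))
                                  (sigma_mx Y)).
Local Notation I := ('I_n * 'I_n)%type.
Local Notation Z := (fun w => hadamard (adjacency_mx R (G w)) (Y w)).

Lemma hadamard_sym w : (Z w)^T = Z w.
Proof.
have [Gs _ _] := G_erdos_renyi; have [_ Ys _ _] := Y_iid.
by apply/matrixP => i j; rewrite !mxE (Gs w).1 Ys.
Qed.

Lemma hadamard_diag w i : Z w i i = 0.
Proof. by have [Y0 _ _ _] := Y_iid; rewrite !mxE Y0 mulr0. Qed.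

(** Some edge has weight at least [t], unless [n (n - 1) / 2] independent
    events of probability [p mu([t, +oo[)] all fail. *)
Lemma lower_tail (t : R) (A : set T) :
  0 <= p <= 1 -> measurable A -> (forall w, A w -> lambda1 (Z w) < t) ->
  (P A <= (expR (- (p * fine (mu [set x | t <= x]) * (n%:R * (n%:R - 1) / 2))))%:E)%E.
Proof.
move=> /andP[p0 p1] mA hA.
pose U (_ : I) := [set x : R | t <= x].
have mt : measurable [set x : R | t <= x].
  rewrite (_ : [set x : R | t <= x] = `[t, +oo[%classic) //.
  by apply/seteqP; split=> x; rewrite /= in_itv /= andbT.
have mU e : measurable (U e) by [].
pose E e := edge_event G Y [set e]%SET U.
have EE e w : E e w <-> G w e.1 e.2 /\ U e (Y w e.1 e.2).
  split=> [h|h f]; first by apply: h; rewrite inE.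
  by rewrite inE => /eqP ->.
have mE e : measurable (E e).
  exact: (measurable_edge_event G_erdos_renyi Y_iid).
pose q := p * fine (mu [set x | t <= x]).
have := prob_none mE (q := fun _ => q) (D := [set e in @upper_pair n]%SET).
have hq (J : {set I}) : J \subset [set e in @upper_pair n]%SET ->
  P [set w | forall e, e \in J -> E e w] = (\prod_(e in J) q)%:E.
  move=> /fintype.subsetP JD.
  rewrite -(edge_event_prob G_erdos_renyi Y_iid XY_independent (J := J) (U := U)) //.
    by congr (P _); apply/seteqP; split=> w /= h e /h /EE.
  by move=> e /JD; rewrite inE.
move=> /(_ P hq); rewrite prodr_const => hP.
apply: (@le_trans _ _ (P [set w | forall e, e \in [set e in @upper_pair n]%SET -> ~ E e w])).
  apply: le_measure; rewrite ?inE //.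
    have := measurable_all_none mE finset.set0 [set e in @upper_pair n]%SET.
    congr (measurable _); apply/seteqP; split=> w /= => [[]//|h].
    by split=> // i; rewrite inE.
  move=> w /hA lt e; rewrite !inE => eu /EE[Ge Ue].
  have := entry_le_lambda1 (i := e.1) (j := e.2) (hadamard_sym w) (hadamard_diag w).
  have e12 : e.1 != e.2 by rewrite -val_eqE /= ltn_eqF.
  move=> /(_ e12); rewrite !mxE Ge mul1r => h.
  by have := lt_le_trans lt Ue; rewrite ltNge h.
rewrite hP lee_fin.
have q01 : 0 <= 1 - q.
  rewrite subr_ge0 /q mulr_ile1 ?fine_ge0 //.
  by rewrite -lee_fin fineK ?fin_num_measure // probability_le1.
apply: (@le_trans _ _ (expR (- q) ^+ #|[set e in @upper_pair n]%SET|)).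
  by apply: lerXn2r; rewrite ?nnegrE ?expR_ge0 //; exact: expR_ge1Dx.
rewrite -expRM_natl ler_expR -mulr_natl.
have := congr1 (fun k => k%:R : R) (card_upper_pair n).
rewrite natrD !natrM -/q => h.
rewrite mulrN lerN2 mulrC mulr1.
by have -> : n%:R * (n%:R - 1) / 2 = #|[set e in @upper_pair n]%SET|%:R :> R by lra.
Qed.
End LowerTail.

(** * Walks of length two *)

Lemma sum_subsets_expr (R : comRingType) (I : finType) (D : {set I}) (x : R) :
  \sum_(S : {set I} | S \subset D) x ^+ #|S| = (1 + x) ^+ #|D|.
Proof.
transitivity (\prod_(i : I) ((if i \in D then x else 0) + 1)); last first.
  rewrite -prodr_const [RHS]big_mkcond /=; apply: eq_bigr => i _.
  by case: ifP; rewrite ?add0r // addrC.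
rewrite (@bigA_distr R 0 1 *%R +%R I) /= big_mkcond /=.
apply: eq_bigr => S _; rewrite -big_mkcond /=.
case: ifPn => [/fintype.subsetP SD|/subsetPn[i iS iD]].
  by rewrite -prodr_const; apply: eq_bigr => i /SD ->.
by rewrite (bigD1 i) //= (negPf iD) mul0r.
Qed.

Section TwoWalks.
Context {n : nat}.
Local Notation I := ('I_n * 'I_n)%type.

Definition star (v : 'I_n) (A : {set 'I_n}) : {set I} :=
  [set edge v u | u in A]%SET.

Definition second_edges (v : 'I_n) (A : {set 'I_n}) : {set I} :=
  [set e in @upper_pair n |
    [&& e.1 != v, e.2 != v & (e.1 \in A) || (e.2 \in A)]]%SET.

Lemma card_star v A : #|star v A| = #|A|.
Proof.
apply: card_in_imset => x y _ _; rewrite /edge.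
by case: ltnP => hx; case: ltnP => hy [] // ? ?; subst; rewrite // ltnn in hx hy *.
Qed.

Lemma star_second v A e : e \in star v A -> e \notin second_edges v A.
Proof.
by move=> /imsetP[u _ ->]; rewrite inE /edge; case: ifP => _ /=;
   rewrite eqxx /= ?andbF.
Qed.

Lemma card_second_edges v A : (#|second_edges v A| <= #|A| * n)%N.
Proof.
have sub : second_edges v A \subset
    ((fun q : I => edge q.1 q.2) @: finset.setX A [set: 'I_n])%SET.
  apply/fintype.subsetP => e; rewrite inE => /and4P[eu _ _ /orP[h|h]].
    by apply/imsetP; exists e; rewrite ?edge_id // finset.inE h finset.in_setT.
  apply/imsetP; exists (e.2, e.1); rewrite /= 1?edgeC ?edge_id //.
  by rewrite finset.in_setX h finset.in_setT.
apply: (leq_trans (subset_leq_card sub)).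
by apply: (leq_trans (leq_imset_card _ _)); rewrite cardsX cardsT card_ord.
Qed.

(** A walk of length two from [v] returns to [v] or traverses, in one of its
    two directions, an edge that avoids [v] and meets a neighbour of [v]. *)
Lemma two_walks_le (g : rel 'I_n) v : symmetric g -> irreflexive g ->
  (\sum_j \sum_k (g v j * g j k) <= #|[set u | g v u]%SET| +
   2 * #|[set e in second_edges v [set u | g v u] | g e.1 e.2]%SET|)%N.
Proof.
move=> sg ig; set A := [set u | _]%SET; set S := [set e in _ | _]%SET.
pose Q := [set e : I | [&& g v e.1, e.2 != v & g e.1 e.2]]%SET.
have hQ : (#|Q| <= 2 * #|S|)%N.
  have sub : Q \subset (S :|: [set (e.2, e.1) | e in S])%SET.
    apply/fintype.subsetP => -[a b]; rewrite finset.in_setU inE /= => /and3P[va bv ab].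
    have av : a != v.
      by apply: contraTneq va => ->; rewrite ig.
    case: (ltngtP a b) => [lt|lt|/ord_inj e]; last by rewrite e ig in ab.
      by apply/orP; left; rewrite !inE /= lt av bv va ab.
    apply/orP; right; apply/imsetP; exists (b, a) => //.
    by rewrite !inE /= lt av bv va orbT sg ab.
  apply: (leq_trans (subset_leq_card sub)).
  apply: (leq_trans (leq_card_setU _ _)).
  by rewrite mul2n -addnn leq_add2l leq_imset_card.
apply: leq_trans (_ : (#|A| + #|Q| <= _)%N); last by rewrite leq_add2l.
have -> : #|Q| = (\sum_j \sum_k ((k != v) && g v j && g j k))%N.
  rewrite -sum1_card big_mkcond pair_big /=; apply: eq_bigr => -[j k] _ /=.
  by rewrite inE /=; case: (g v j); case: (k != v); case: (g j k).
have -> : #|A| = (\sum_j \sum_k ((k == v) && g v j))%N.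
  rewrite -sum1_card big_mkcond; apply: eq_bigr => j _.
  rewrite (bigD1 v) //= eqxx big1 ?addn0; first by rewrite inE; case: (g v j).
  by move=> k /negPf ->.
rewrite -big_split; apply: leq_sum => j _; rewrite -big_split; apply: leq_sum => k _ /=.
by case: (g v j); case: (g j k); case: (k == v).
Qed.

End TwoWalks.

Section TwoWalksProb.
Context (d : measure_display) (T : measurableType d) (R : realType)
  (P : probability T R) (n : nat) (p c : R) (mu : probability R R)
  (G : T -> rel 'I_n) (Y : T -> 'M[R]_n).
Hypotheses (G_erdos_renyi : erdos_renyi P p G)
  (Y_iid : iid_symmetric_mx P mu Y)
  (XY_independent : independent P (sigma_mx (fun w => adjacency_mx R (G w)))
                                  (sigma_mx Y))
  (p0 : 0 <= p) (pn : p * n%:R = c).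
Local Notation I := ('I_n * 'I_n)%type.

(** The sets [A] and [S] play the roles of the neighbours of [v] and of the
    edges at distance one from [v]; the sum over all [A] and [S] of
    [e^(#|A| + 2 #|S|) p^(#|A| + #|S|)] stays bounded. *)
Lemma two_walks_tail (M : R) :
  exists B : set T, [/\ measurable B,
    (P B <= (n%:R * expR (- M) * expR (c * expR (1 + c * expR 2)))%:E)%E &
    forall w, ~ B w -> forall i,
      \sum_j \sum_k ((G w i j)%:R * (G w j k)%:R) <= M].
Proof.
pose D := [pred q : 'I_n * ({set 'I_n} * {set I}) |
  [&& q.1 \notin q.2.1, q.2.2 \subset second_edges q.1 q.2.1 &
      M <= (#|q.2.1| + 2 * #|q.2.2|)%:R]].
pose U (_ : I) := [set: R].
have mU e : measurable (U e) by exact: measurableT.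
pose E (q : 'I_n * ({set 'I_n} * {set I})) :=
  edge_event G Y (star q.1 q.2.1 :|: q.2.2)%SET U.
pose b (q : 'I_n * ({set 'I_n} * {set I})) :=
  expR (- M) * ((expR 1 * p) ^+ #|q.2.1| * (expR 2 * p) ^+ #|q.2.2|).
have b0 q : 0 <= b q by rewrite !mulr_ge0 ?exprn_ge0 ?mulr_ge0 ?expR_ge0.
have mE q : q \in D -> measurable (E q).
  by move=> _; exact: (measurable_edge_event G_erdos_renyi Y_iid).
have hE q : q \in D -> (P (E q) <= (b q)%:E)%E.
  case: q => v [A S]; rewrite inE /= => /and3P[vA ST hM].
  rewrite /E (edge_event_prob G_erdos_renyi Y_iid XY_independent) //; last first.
    move=> e; rewrite finset.in_setU => /orP[/imsetP[u uA ->]|].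
      by apply: edge_upper; apply: contraNneq vA => /= ->.
    by move=> /(fintype.subsetP ST); rewrite !inE => /andP[].
  rewrite lee_fin /U probability_setT /= mulr1 prodr_const cardsU.
  have -> : (star v A :&: S = finset.set0)%SET.
    apply/setP => e; rewrite !inE; apply/negP => /andP[e1 e2].
    have := star_second e1; rewrite (fintype.subsetP ST _ e2) //.
  rewrite cards0 subn0 card_star /b /= !exprMn exprD.
  rewrite -!expRM_natl mulr1.
  have e1 : 1 <= expR (- M) * (expR #|A|%:R * expR (#|S|%:R * 2)).
    rewrite -!expRD -[X in X <= _]expR0 ler_expR.
    move: hM; rewrite natrD natrM; lra.
  rewrite -[X in X <= _]mul1r.
  have -> : forall x y z t u : R, x * (y * z * (t * u)) = x * (y * t) * (z * u).
    by move=> *; ring.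
  by apply: ler_wpM2r => //; rewrite mulr_ge0 ?exprn_ge0.
have [mB PB] := union_event mE hE.
exists [set w | exists2 q, q \in D & E q w]; split=> //.
  apply: (le_trans PB); rewrite lee_fin.
  apply: (@le_trans _ _ (\sum_(v : 'I_n) \sum_(A : {set 'I_n})
     \sum_(S : {set I} | S \subset second_edges v A) b (v, (A, S)))).
    under [X in _ <= X]eq_bigr => v _ do rewrite pair_big_dep /=.
    rewrite pair_big_dep /= big_mkcond [X in _ <= X]big_mkcond /=.
    apply: ler_sum => -[v [A S]] _ /=; rewrite inE /=.
    by case: (v \notin A); case: (S \subset _); case: (M <= _) => /=.
  have n0 : 0 <= n%:R :> R by [].
  pose y := expR (1 + c * expR 2) * p.
  have y0 : 0 <= y by rewrite mulr_ge0 ?expR_ge0.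
  have yE : y = expR 1 * p * expR (c * expR 2) by rewrite /y expRD; ring.
  have hA v (A : {set 'I_n}) :
     \sum_(S : {set I} | S \subset second_edges v A) b (v, (A, S))
     <= expR (- M) * y ^+ #|A|.
    rewrite /b /= -mulr_sumr ler_wpM2l ?expR_ge0 //.
    rewrite -mulr_sumr sum_subsets_expr yE.
    rewrite [X in _ <= X]exprMn ler_wpM2l ?exprn_ge0 ?mulr_ge0 ?expR_ge0 //.
    apply: (@le_trans _ _ (expR (expR 2 * p) ^+ #|second_edges v A|)).
      apply: lerXn2r; rewrite ?nnegrE ?addr_ge0 ?mulr_ge0 ?expR_ge0 //.
      exact: expR_ge1Dx.
    rewrite -!expRM_natl ler_expR.
    apply: (@le_trans _ _ ((#|A| * n)%:R * (expR 2 * p))).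
      by rewrite ler_wpM2r ?mulr_ge0 ?expR_ge0 // ler_nat card_second_edges.
    by rewrite natrM -pn le_eqVlt; apply/orP; left; apply/eqP; ring.
  apply: (@le_trans _ _ (\sum_(v : 'I_n) expR (- M) * expR (c * expR (1 + c * expR 2)))).
    apply: ler_sum => v _.
    apply: (le_trans (ler_sum _ (fun A _ => hA v A))).
    rewrite -mulr_sumr ler_wpM2l ?expR_ge0 //.
    have := sum_subsets_expr [set: 'I_n]%SET y.
    rewrite cardsT card_ord (eq_bigl xpredT); last by move=> S; rewrite finset.subsetT.
    move=> ->.
    apply: (@le_trans _ _ (expR y ^+ n)).
      apply: lerXn2r; rewrite ?nnegrE ?addr_ge0 ?expR_ge0 //; exact: expR_ge1Dx.
    by rewrite -expRM_natl ler_expR /y -pn le_eqVlt; apply/orP; left; apply/eqP; ring.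
  by rewrite sumr_const card_ord -[_ *+ n]mulr_natl mulrA.
move=> w nB i; rewrite leNgt; apply/negP => hM; apply: nB.
have [Gs _ _] := G_erdos_renyi; have [sg ig] := Gs w.
pose A := [set u | G w i u]%SET.
pose S := [set e in second_edges i A | G w e.1 e.2]%SET.
exists (i, (A, S)).
  rewrite inE /= inE ig /=; apply/andP; split.
    by apply/fintype.subsetP => e; rewrite inE => /andP[].
  apply: (le_trans (ltW hM)).
  under eq_bigr => j _.
    under eq_bigr => k _ do rewrite -natrM.
    rewrite -natr_sum; over.
  rewrite -natr_sum ler_nat; exact: two_walks_le.
move=> e; rewrite finset.in_setU => /orP[/imsetP[u uA ->]|eS]; split=> //=.
  by rewrite inE in uA; rewrite /edge; case: ifP => _ //=; rewrite sg.
by move: eS; rewrite inE => /andP[].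
Qed.

End TwoWalksProb.

(** * Clusters of heavy edges *)

(** Weights are compared only through the integer part of [`|x| `^ alpha]: it
    is at least [l] with probability of order [expR (- l%:R)] for every
    [alpha], and a union bound can run over its values. *)
Definition level (R : realType) (alpha : R) (l : nat) : set R :=
  [set x | l%:R <= `|x| `^ alpha].

Lemma le_powR_inv (R : realType) (a x y : R) : 0 < a -> 0 <= x -> 0 <= y ->
  (x <= y `^ a) = (x `^ a^-1 <= y).
Proof.
move=> a0 x0 y0; have ai0 : 0 < a^-1 by rewrite invr_gt0.
have [h|h] := leP x (y `^ a).
  apply/esym; have := ge0_ler_powR (ltW ai0) _ _ h.
  by rewrite !nnegrE -powRrM divff ?gt_eqF // powRr1 //; apply => //; exact: powR_ge0.
apply/esym/negbTE; rewrite -ltNge.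
have := gt0_ltr_powR ai0 _ _ h.
by rewrite !nnegrE -powRrM divff ?gt_eqF // powRr1 //; apply => //; exact: powR_ge0.
Qed.

Lemma levelE (R : realType) (alpha : R) l : 0 < alpha ->
  level alpha l = [set x | l%:R `^ alpha^-1 <= x] `|` [set x | x <= - (l%:R `^ alpha^-1)].
Proof.
move=> a0; apply/seteqP; split=> x; rewrite /level /= le_powR_inv // ler_normr.
  by move=> /orP[h|h]; [left|right]; rewrite // lerNr.
by move=> [->//|]; rewrite lerNr => ->; rewrite orbT.
Qed.

Lemma measurable_level (R : realType) (alpha : R) l : 0 < alpha ->
  measurable (level alpha l).
Proof.
move=> a0; rewrite levelE //; apply: measurableU.
  rewrite (_ : mkset _ = `[l%:R `^ alpha^-1, +oo[%classic) //.
  by apply/seteqP; split=> x; rewrite /= in_itv /= andbT.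
by rewrite (_ : mkset _ = `]-oo, - (l%:R `^ alpha^-1)]%classic).
Qed.

Lemma weibull_level (R : realType) (alpha : R) (mu : probability R R) :
  0 < alpha -> weibull alpha mu ->
  exists2 C : R, 0 < C &
    forall l, (mu (level alpha l) <= (C * expR (- l%:R))%:E)%E.
Proof.
move=> a0 [C1 [C2 [C10 C20 h]]].
(* For [l <= 1] the tail bounds say nothing, and [expR 1] makes the bound
   at least one. *)
exists (C2 + expR 1) => [|l]; first by rewrite addr_gt0 // expR_gt0.
have [l1|l1] := ltnP 1 l; last first.
  apply: (le_trans (probability_le1 _ (measurable_level l a0))).
  rewrite lee_fin mulrDl -expRD.
  apply: le_trans (_ : expR (1 - l%:R) <= _); last first.
    by rewrite lerDr mulr_ge0 ?expR_ge0 // ltW.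
  by rewrite -[X in X <= _]expR0 ler_expR subr_ge0 lern1.
pose t : R := l%:R `^ alpha^-1.
have ta : t `^ alpha = l%:R by rewrite /t -powRrM mulVf ?gt_eqF // powRr1.
have t1 : 1 < t.
  have ai0 : 0 < alpha^-1 by rewrite invr_gt0.
  have := gt0_ltr_powR (r := alpha^-1) ai0 (x := 1) (y := l%:R).
  by rewrite !nnegrE powR1; apply => //; rewrite ltr1n.
have [/andP[_ hu] /andP[_ hd]] := h t t1.
have mu1 : measurable [set x : R | t <= x].
  rewrite (_ : mkset _ = `[t, +oo[%classic) //.
  by apply/seteqP; split=> x; rewrite /= in_itv /= andbT.
have md1 : measurable [set x : R | x <= - t].
  by rewrite (_ : mkset _ = `]-oo, - t]%classic).
rewrite levelE // -/t; apply: (le_trans (measureU2 _ mu1 md1)).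
apply: (le_trans (leeD hu hd)).
rewrite -EFinD lee_fin ta -mulrDl -splitr mulrDl lerDl.
by rewrite mulr_ge0 ?expR_ge0.
Qed.

Section HeavyEdges.
Context (d : measure_display) (T : measurableType d) (R : realType)
  (P : probability T R) (n : nat) (p c C alpha : R) (mu : probability R R)
  (G : T -> rel 'I_n) (Y : T -> 'M[R]_n).
Hypotheses (G_erdos_renyi : erdos_renyi P p G)
  (Y_iid : iid_symmetric_mx P mu Y)
  (XY_independent : independent P (sigma_mx (fun w => adjacency_mx R (G w)))
                                  (sigma_mx Y))
  (p0 : 0 <= p) (pn : p * n%:R = c) (alpha0 : 0 < alpha) (C0 : 0 < C)
  (hC : forall l, (mu (level alpha l) <= (C * expR (- l%:R))%:E)%E).
Local Notation I := ('I_n * 'I_n)%type.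

Lemma level_event_prob (J : {set I}) (l : I -> nat) :
  {subset J <= @upper_pair n} ->
  (P (edge_event G Y J (fun e => level alpha (l e))) <=
   ((p * C) ^+ #|J| * expR (- (\sum_(e in J) l e)%:R))%:E)%E.
Proof.
move=> Ju.
rewrite (edge_event_prob G_erdos_renyi Y_iid XY_independent) //; last first.
  by move=> e; exact: measurable_level.
rewrite lee_fin natr_sum -sumrN expR_sum -prodr_const -big_split /=.
apply: ler_prod => e _; have ml := measurable_level (l e) alpha0.
apply/andP; split; first by rewrite mulr_ge0 ?fine_ge0.
rewrite -mulrA ler_wpM2l //.
by rewrite -lee_fin fineK ?fin_num_measure.
Qed.

(** Union bound over clusters and over the possible levels of their edges.
    The levels are truncated at [m], which leaves [m.+1] values for each. *)
Lemma heavy_cluster_tail (K m : nat) (S : R) : 1 <= c * C ->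
  exists B : set T, [/\ measurable B,
    (P B <= (n%:R * K.+1%:R * ((2 * K).+1%:R * m.+1%:R * (c * C)) ^+ K
             * expR (- S))%:E)%E &
    forall w, ~ B w -> forall v k (J : {set I}) (l : I -> 'I_m.+1),
      (k <= K)%N -> J \in clusters v k -> S <= (\sum_(e in J) l e)%:R ->
      ~ edge_event G Y J (fun e => level alpha (l e)) w].
Proof.
move=> cC1.
pose Q : finType := ('I_n * ('I_K.+1 * ({set I} * {ffun I -> 'I_m.+1})))%type.
pose D := [pred q : Q | [&& q.2.2.1 \in clusters q.1 q.2.1,
  q.2.2.2 \in pffun_on ord0 (mem q.2.2.1) predT &
  S <= (\sum_(e in q.2.2.1) q.2.2.2 e)%:R]].
pose E (q : Q) := edge_event G Y q.2.2.1 (fun e => level alpha (q.2.2.2 e)).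
pose b (q : Q) := (p * C) ^+ q.2.1 * expR (- S).
have pC0 : 0 <= p * C by rewrite mulr_ge0 // ltW.
have b0 q : 0 <= b q by rewrite mulr_ge0 ?expR_ge0 // exprn_ge0.
have mE q : q \in D -> measurable (E q).
  move=> _; apply: (measurable_edge_event G_erdos_renyi Y_iid) => e.
  exact: measurable_level.
have hE q : q \in D -> (P (E q) <= (b q)%:E)%E.
  case: q => v [k [J l]]; rewrite inE /= => /and3P[Jc _ hS].
  apply: (le_trans (level_event_prob _ (cluster_upper Jc))).
  rewrite lee_fin /b /= (cluster_card Jc) ler_wpM2l ?exprn_ge0 //.
  by rewrite ler_expR lerN2.
have [mB PB] := union_event mE hE.
exists [set w | exists2 q, q \in D & E q w]; split=> //.
  apply: (le_trans PB); rewrite lee_fin.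
  pose a := (2 * K).+1%:R * m.+1%:R * (c * C) : R.
  have a1 : 1 <= a.
    rewrite /a -natrM mulr_ege1 // ler1n muln_gt0 //.
  apply: (@le_trans _ _ (\sum_(v : 'I_n) \sum_(k : 'I_K.+1)
    \sum_(J in clusters v k)
      \sum_(l in pffun_on (ord0 : 'I_m.+1) (mem J) predT) b (v, (k, (J, l))))).
    under [X in _ <= X]eq_bigr => v _.
      under eq_bigr => k _ do rewrite pair_big_dep /=.
      rewrite pair_big_dep /=; over.
    rewrite pair_big_dep /= big_mkcond [X in _ <= X]big_mkcond /=.
    apply: ler_sum => -[v [k [J l]]] _ /=.
    case: ifP => [/and3P[/= h1 h2 _]|_]; first by rewrite h1 h2.
    by case: ifP.
  apply: (@le_trans _ _ (\sum_(v : 'I_n) \sum_(k : 'I_K.+1) (a ^+ K * expR (- S)))); last first.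
    by rewrite !sumr_const !card_ord -/a le_eqVlt; apply/orP; left; apply/eqP; ring.
  apply: ler_sum => v _; apply: ler_sum => k _.
  have e1 (J : {set I}) : J \in clusters v k ->
    \sum_(l in pffun_on (ord0 : 'I_m.+1) (mem J) predT) b (v, (k, (J, l)))
    = (m.+1%:R * (p * C)) ^+ k * expR (- S).
    move=> Jc; rewrite /b /= sumr_const card_pffun_on.
    rewrite (_ : #|_| = m.+1); last by rewrite -[RHS]card_ord; exact: eq_card.
    by rewrite (cluster_card Jc) -[_ *+ _]mulr_natl exprMn natrX !exprMn mulrA.
  rewrite (eq_bigr _ e1) sumr_const -[_ *+ _]mulr_natl mulrA.
  rewrite ler_wpM2r ?expR_ge0 //.
  apply: (@le_trans _ _ (a ^+ k)); last by rewrite ler_weXn2l // -ltnS.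
  have -> : a ^+ k = (((2 * K).+1 * n) ^ k)%:R * (m.+1%:R * (p * C)) ^+ k.
    by rewrite natrX -exprMn /a -pn natrM; congr (_ ^+ _); ring.
  apply: ler_wpM2r; first by rewrite exprn_ge0 // mulr_ge0.
  rewrite ler_nat; by apply: card_clusters; rewrite -ltnS.
move=> w nB v k J l kK Jc hS hE'; apply: nB.
pose l' := [ffun e => if e \in J then l e else ord0].
have l'E e : e \in J -> l' e = l e by rewrite ffunE => ->.
exists (v, (Ordinal (kK : (k < K.+1)%N), (J, l'))).
  rewrite inE /= Jc /=; apply/andP; split.
    apply/pffun_onP; split=> //; apply/fintype.subsetP => e.
    by rewrite !inE ffunE; case: ifP; rewrite // eqxx.
  by rewrite (eq_bigr (fun e => l e : nat)) // => e /l'E ->.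
by move=> e eJ /=; rewrite l'E //; exact: hE'.
Qed.

Lemma edge_inj (i j k : 'I_n) : edge i j = edge i k -> j = k.
Proof.
rewrite /edge; case: ltnP => h1; case: ltnP => h2 [] // a b; subst=> //.
Qed.

(** There are [n ^ 3] triples of vertices, and a factor [p] for each of the
    three edges: only the factor due to the weights remains. *)
Lemma heavy_triangle_tail (l : nat) :
  exists B : set T, [/\ measurable B,
    (P B <= ((c * C) ^+ 3 * expR (- (3 * l)%:R))%:E)%E &
    forall w, ~ B w -> forall i j k, i != j -> i != k -> j != k ->
      ~ edge_event G Y [set edge i j; edge i k; edge j k]%SET
          (fun=> level alpha l) w].
Proof.
pose Q : finType := ('I_n * ('I_n * 'I_n))%type.
pose D := [pred q : Q | [&& q.1 != q.2.1, q.1 != q.2.2 & q.2.1 != q.2.2]].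
pose J (q : Q) : {set I} := [set edge q.1 q.2.1; edge q.1 q.2.2; edge q.2.1 q.2.2]%SET.
pose E (q : Q) := edge_event G Y (J q) (fun=> level alpha l).
pose b (q : Q) := (p * C) ^+ 3 * expR (- (3 * l)%:R).
have pC0 : 0 <= p * C by rewrite mulr_ge0 // ltW.
have b0 q : 0 <= b q by rewrite mulr_ge0 ?expR_ge0 // exprn_ge0.
have mE q : q \in D -> measurable (E q).
  move=> _; apply: (measurable_edge_event G_erdos_renyi Y_iid) => e.
  exact: measurable_level.
have hE q : q \in D -> (P (E q) <= (b q)%:E)%E.
  case: q => i [j k]; rewrite inE /= => /and3P[ij ik jk].
  have J3 : #|J (i, (j, k))| = 3%N.
    rewrite /J /= -finset.setUA !cardsU1 cards1 !inE.
    have -> : (edge i j == edge i k) = false.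
      by apply: contraNF jk => /eqP /edge_inj ->.
    have -> : (edge i j == edge j k) = false.
      by apply: contraNF ik => /eqP; rewrite (edgeC i j) => /edge_inj ->.
    have -> : (edge i k == edge j k) = false.
      by apply: contraNF ij => /eqP; rewrite !(edgeC _ k) => /edge_inj ->.
    by [].
  apply: (le_trans (level_event_prob _ _)).
    move=> e; rewrite /J /= !inE -orbA => /or3P[] /eqP ->; exact: edge_upper.
  by rewrite lee_fin J3 sum_nat_const J3.
have [mB PB] := union_event mE hE.
exists [set w | exists2 q, q \in D & E q w]; split=> //.
  apply: (le_trans PB); rewrite lee_fin.
  apply: (@le_trans _ _ (\sum_(q : Q) b q)).
    rewrite big_mkcond /=; apply: ler_sum => q _; by case: ifP.
  rewrite /b sumr_const !card_prod !card_ord -[_ *+ _]mulr_natl mulrA.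
  rewrite -pn !natrM ler_wpM2r ?expR_ge0 // le_eqVlt; apply/orP; left; apply/eqP.
  by ring.
move=> w nB i j k ij ik jk hw; apply: nB.
by exists (i, (j, k)) => //; rewrite inE /= ij ik jk.
Qed.

End HeavyEdges.

(** * The upper tail *)

(** Each term [x i `^ b] is at most [x i] times the [(b - 1)]-th power of the
    sum. *)
Lemma sum_powR_le (R : realType) (I : finType) (J : {pred I}) (x : I -> R) (b : R) :
  (forall i, 0 <= x i) -> 1 <= b ->
  \sum_(i in J) x i `^ b <= (\sum_(i in J) x i) `^ b.
Proof.
move=> x0 b1; have b0 : 0 < b by exact: lt_le_trans b1.
set X := \sum_(i in J) x i.
have X0 : 0 <= X by apply: sumr_ge0.
rewrite -(mulr_powRB1 X0 b0) {1}/X mulr_suml.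
apply: ler_sum => i iJ; rewrite -(mulr_powRB1 (x0 i) b0) ler_wpM2l //.
apply: ge0_ler_powR; rewrite ?subr_ge0 ?nnegrE //.
by rewrite /X (bigD1 i) //= lerDl sumr_ge0.
Qed.

Section UpperTail.
Context (d : measure_display) (T : measurableType d) (R : realType)
  (P : probability T R) (n : nat) (p c C alpha : R) (mu : probability R R)
  (G : T -> rel 'I_n) (Y : T -> 'M[R]_n).
Hypotheses (G_erdos_renyi : erdos_renyi P p G)
  (Y_iid : iid_symmetric_mx P mu Y)
  (XY_independent : independent P (sigma_mx (fun w => adjacency_mx R (G w)))
                                  (sigma_mx Y))
  (p0 : 0 <= p) (pn : p * n%:R = c) (n0 : (0 < n)%N)
  (alpha0 : 0 < alpha) (alpha2 : alpha < 2) (C0 : 0 < C) (cC1 : 1 <= c * C)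
  (hC : forall l, (mu (level alpha l) <= (C * expR (- l%:R))%:E)%E).
Local Notation I := ('I_n * 'I_n)%type.
Local Notation Z := (fun w => hadamard (adjacency_mx R (G w)) (Y w)).

(** The largest sum of squares compatible with the bound [S] on the sum of the
    levels is that of a single edge, because [2 / alpha >= 1]. *)
Lemma sum_sqr_le (w : T) (J : {set I}) (l : I -> nat) (S rho : R) :
  (forall e, e \in J -> `|Y w e.1 e.2| `^ alpha <= rho * (l e)%:R) ->
  0 <= rho -> (\sum_(e in J) l e)%:R <= S ->
  \sum_(e in J) Y w e.1 e.2 ^+ 2 <= ((rho * S) `^ alpha^-1) ^+ 2.
Proof.
move=> hl rho0 hS.
have S0 : 0 <= S by apply: le_trans hS.
pose x e := `|Y w e.1 e.2| `^ alpha.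
have b1 : 1 <= 2 / alpha by rewrite ler_pdivlMr // mul1r ltW.
have Yx e : Y w e.1 e.2 ^+ 2 = x e `^ (2 / alpha).
  rewrite /x -powRrM mulrCA divff ?gt_eqF // mulr1 powR_mulrn //.
  by rewrite real_normK ?num_real.
under eq_bigr do rewrite Yx.
apply: (le_trans (sum_powR_le _ _ _)) => //; first by move=> e; exact: powR_ge0.
rewrite -powR_mulrn ?powR_ge0 // -powRrM [alpha^-1 * 2]mulrC.
apply: ge0_ler_powR; rewrite ?nnegrE.
- by rewrite (le_trans _ b1).
- by rewrite sumr_ge0 // => e _; exact: powR_ge0.
- exact: mulr_ge0.
apply: (le_trans (ler_sum _ hl)).
by rewrite -mulr_sumr -natr_sum ler_wpM2l.
Qed.

(** Outside the three exceptional events, [lambda1_le_split] applies with the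
    heavy edges as live edges.  A cluster of [K] heavy edges would have levels
    summing to at least [K * l0 >= S], so a live cluster has fewer than [K]
    edges and levels summing to less than [S].  The factor [rho] makes up for
    the fractional parts of the [`|Y| `^ alpha], which are small compared with
    [l0]. *)
Lemma upper_tail (K m l0 : nat) (S M rho : R) (A : set T) :
  0 < S -> 0 < M -> (0 < l0)%N -> l0.+1%:R <= rho * l0%:R ->
  S <= (K * l0)%:R -> S <= m%:R -> (l0 <= m)%N ->
  measurable A ->
  (forall w, A w ->
    (rho * S) `^ alpha^-1 + l0%:R `^ alpha^-1 * Num.sqrt M < lambda1 (Z w)) ->
  (P A <=
    (n%:R * expR (- M) * expR (c * expR (1 + c * expR 2))
     + n%:R * K.+1%:R * ((2 * K).+1%:R * m.+1%:R * (c * C)) ^+ K * expR (- S)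
     + (c * C) ^+ 3 * expR (- (3 * l0)%:R))%:E)%E.
Proof.
move=> S0 M0 l00 hrho SK Sm lm mA hA.
have [B1 [mB1 PB1 hB1]] :=
  two_walks_tail G_erdos_renyi Y_iid XY_independent p0 pn M.
have [B2 [mB2 PB2 hB2]] :=
  heavy_cluster_tail G_erdos_renyi Y_iid XY_independent p0 pn alpha0 C0 hC K m S cC1.
have [B3 [mB3 PB3 hB3]] :=
  heavy_triangle_tail G_erdos_renyi Y_iid XY_independent p0 pn alpha0 C0 hC l0.
have sub : A `<=` B1 `|` B2 `|` B3.
  move=> w Aw; apply: contrapT => /not_orP[/not_orP[nB1 nB2] nB3].
  have /hB1 h1 := nB1; have /hB2 h2 := nB2; have /hB3 h3 := nB3 => {hB1 hB2 hB3}.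
  have := hA _ Aw; rewrite ltNge => /negP; apply.
  have [Gs _ _] := G_erdos_renyi; have [sg ig] := Gs w.
  have [Y0 Ys _ _] := Y_iid.
  have l0r : 0 < l0%:R :> R by rewrite ltr0n.
  have rho0 : 0 < rho.
    by rewrite -(pmulr_lgt0 _ l0r); apply: lt_le_trans hrho.
  pose live := [set e in @upper_pair n |
    G w e.1 e.2 && (l0%:R <= `|Y w e.1 e.2| `^ alpha)]%SET.
  have lu : {subset live <= @upper_pair n}.
    by move=> e; rewrite inE => /andP[].
  have liveE e : e \in live -> G w e.1 e.2 /\ level alpha l0 (Y w e.1 e.2).
    by rewrite inE => /and3P[].
  pose l (e : I) : nat := Num.truncn (`|Y w e.1 e.2| `^ alpha).
  have lP e : (l e)%:R <= `|Y w e.1 e.2| `^ alpha < (l e).+1%:R.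
    by apply: truncn_itv; exact: powR_ge0.
  have ll e : e \in live -> (l0 <= l e)%N.
    by move=> /liveE[_ h]; rewrite /l truncn_ge_nat ?powR_ge0.
  pose l' (e : I) : 'I_m.+1 := inord (minn m (l e)).
  have l'E e : l' e = minn m (l e) :> nat by rewrite inordK // ltnS geq_minl.
  have nS v k J : (k <= K)%N -> J \in clusters v k -> J \subset live ->
      (\sum_(e in J) l' e)%:R < S.
    move=> kK Jc /fintype.subsetP Jl; rewrite ltNge; apply/negP => hS.
    apply: (h2 v k J l' kK Jc hS) => e /Jl el; split; first by case: (liveE _ el).
    rewrite /level /= l'E; apply: le_trans (andP (lP e)).1.
    by rewrite ler_nat geq_minr.
  apply: (lambda1_le_split (g := G w) (live := live)) => //.
  - exact: (hadamard_sym G_erdos_renyi Y_iid).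
  - by move=> i; rewrite !mxE Y0 mulr0.
  - by apply: powR_gt0; rewrite mulr_gt0.
  - move=> i j el; rewrite !mxE.
    have [gij|] := boolP (G w i j); last by rewrite mul0r normr0 mulr0.
    rewrite mul1r mulr1.
    have ij : i != j by apply: contraTneq gij => ->; rewrite ig.
    have := edge_upper ij; move: el; rewrite inE => + eu; rewrite eu /=.
    have -> : G w (edge i j).1 (edge i j).2.
      by rewrite /edge; case: ifP; rewrite //= sg.
    have -> : Y w (edge i j).1 (edge i j).2 = Y w i j.
      by rewrite /edge; case: ifP => // _ /=; rewrite Ys.
    by rewrite /= le_powR_inv // -ltNge => /ltW.
  - move=> i j k eij eik; apply/negP => ejk.
    have ne a b : edge a b \in live -> a != b.
      move=> /lu; apply: contraTneq => ->.
      by rewrite /edge ltnn inE /= ltnn.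
    apply: (h3 i j k) => [|||e]; rewrite ?ne //.
    by rewrite !inE -orbA => /or3P[] /eqP ->; exact: liveE.
  - move=> v.
    have [J Jc|k [J [kK Jc Jl Jcl]]] := closed_cluster (v := v) (K := K) lu.
      apply/negP => Jl; have := nS _ _ _ (leqnn K) Jc Jl.
      rewrite ltNge => /negP; apply; apply: (le_trans SK).
      rewrite ler_nat -(cluster_card Jc) -sum_nat_const.
      apply: leq_sum => e /(fintype.subsetP Jl) /ll le.
      by rewrite l'E leq_min lm.
    exists J; split=> //.
    have lt := nS _ _ _ (ltnW kK) Jc Jl.
    have Zf e : e \in J -> Z w e.1 e.2 ^+ 2 = Y w e.1 e.2 ^+ 2.
      move=> /(fintype.subsetP Jl) /liveE[ge _].
      by rewrite !mxE ge mul1r.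
    rewrite (eq_bigr _ Zf).
    apply: (sum_sqr_le (l := l)); last 2 first.
    + exact: ltW.
    + apply: le_trans (ltW lt).
      rewrite ler_nat; apply: leq_sum => e eJ; rewrite l'E.
      have [//|ml] := leqP (l e) m; exfalso.
      have := lt; rewrite ltNge => /negP; apply; apply: (le_trans Sm).
      rewrite ler_nat (bigD1 e) //= l'E (minn_idPl _) ?leq_addr //.
      exact: ltnW.
    + move=> e /(fintype.subsetP Jl) /ll le.
      apply: (le_trans (ltW (andP (lP e)).2)).
      have le' : l0%:R <= (l e)%:R :> R by rewrite ler_nat.
      have r1 : 1 <= (rho - 1) * l0%:R by move: hrho; rewrite -natr1; lra.
      have r2 : 0 <= rho - 1.
        by rewrite -(pmulr_lge0 _ l0r); apply: le_trans r1.
      have := ler_wpM2l r2 le'; rewrite -natr1; lra.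
have mB12 : measurable (B1 `|` B2) by exact: measurableU.
have mB123 : measurable (B1 `|` B2 `|` B3) by exact: measurableU.
apply: (@le_trans _ _ (P (B1 `|` B2 `|` B3))).
  by apply: le_measure; rewrite ?inE.
apply: (le_trans (measureU2 _ mB12 mB3)); rewrite EFinD; apply: leeD => //.
by apply: (le_trans (measureU2 _ mB1 mB2)); rewrite EFinD; apply: leeD.
Qed.

End UpperTail.

(** * Choice of the parameters *)

Section Asymptotics.
Context {R : realType}.

Lemma near_powR_ge (g c : R) : 0 < g -> \forall L \near +oo, c <= L `^ g.
Proof.
move=> g0.
near=> L.
apply: (@le_trans _ _ (Num.max 0 c)); first by rewrite le_max lexx orbT.
have L0 : 0 <= L by near: L; apply: nbhs_pinfty_ge; exact: num_real.
by rewrite le_powR_inv // le_max lexx.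
Unshelve. all: by end_near. Qed.

Lemma expRN_le (x : R) : 0 < x -> expR (- x) <= x^-1.
Proof.
move=> x0; rewrite expRN lef_pV2 ?posrE ?expR_gt0 //.
by apply: le_trans (expR_ge1Dx x); rewrite lerDr.
Qed.

(** Clusters have [o(L / ln L)] edges, so that their number is [e^(L + o(L))];
    this is beaten by the probability [e^(- rho L)] that a given one is heavy. *)
Lemma cluster_term_le (rho D c1 g L : R) (K m : nat) :
  1 < rho -> 1 <= D -> 0 < g -> 1 <= L -> L `^ g <= L ->
  c1 = (4 * rho + 4) * (rho + 2) * D ->
  K.+1%:R <= (2 * rho + 2) * (L / L `^ g) -> m.+1%:R <= (rho + 2) * L ->
  1 <= L `^ (g / 2) ->
  2 * (2 * rho + 2) * (c1 + 4 / g) / (rho - 1) <= L `^ (g / 2) ->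
  expR L * K.+1%:R * ((2 * K).+1%:R * m.+1%:R * D) ^+ K * expR (- (rho * L))
    <= expR (- ((rho - 1) * L / 2)).
Proof.
set x := L `^ g; set y := L `^ (g / 2).
move=> rho1 D1 g0 L1 xL c1E Kb mb y1 y3.
have L0 : 0 < L by exact: lt_le_trans L1.
have r0 : 0 < rho by exact: lt_trans rho1.
have D0 : 0 < D by exact: lt_le_trans D1.
have c10 : 0 < c1 by rewrite c1E !mulr_gt0 ?addr_gt0 ?mulr_gt0.
have x0 : 0 < x by exact: powR_gt0.
have y0 : 0 < y by exact: powR_gt0.
have yx : y * y = x.
  by rewrite /x /y -powRD ?(gt_eqF L0) ?implybT // -splitr.
set a := _ * _ * D.
have x1 : 1 <= x by rewrite -yx mulr_ege1.
have LxL : L / x <= L by rewrite ler_pdivrMr // ler_peMr // ltW.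
have h1 : (2 * K).+1%:R <= (4 * rho + 4) * L.
  apply: (@le_trans _ _ (2 * K.+1%:R)).
    by rewrite -natrM ler_nat mulnS add2n.
  apply: (@le_trans _ _ (2 * ((2 * rho + 2) * (L / x)))); first by rewrite ler_wpM2l.
  have -> : 2 * ((2 * rho + 2) * (L / x)) = (4 * rho + 4) * (L / x) by ring.
  by rewrite ler_wpM2l // addr_ge0 ?mulr_ge0 // ltW.
have ab : a <= c1 * (L * L).
  have -> : c1 * (L * L) = (4 * rho + 4) * L * ((rho + 2) * L) * D.
    by rewrite c1E; ring.
  by rewrite /a ler_wpM2r ?ler_pM // ltW.
have a1 : K.+1%:R <= a.
  rewrite /a -mulrA; apply: (@le_trans _ _ ((2 * K).+1%:R * 1)).
    by rewrite mulr1 ler_nat ltnS leq_pmull.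
  by rewrite ler_wpM2l // mulr_ege1 // ler1n.
have a0 : 0 < a by apply: lt_le_trans a1; rewrite ltr0n.
have lna : ln a <= (c1 + 4 / g) * y.
  apply: (@le_trans _ _ (ln (c1 * (L * L)))).
    by rewrite ler_ln ?posrE // !mulr_gt0.
  rewrite lnM ?posrE ?mulr_gt0 // lnM ?posrE // mulrDl.
  apply: lerD.
    by apply: (le_trans (ltW (ln_sublinear c10))); rewrite ler_peMr // ltW.
  have := ln_sublinear y0; rewrite {1}/y ln_powR => /ltW h.
  have -> : ln L + ln L = 4 / g * (g / 2 * ln L) by field; rewrite gt_eqF.
  by rewrite ler_wpM2l // divr_ge0 // ltW.
have lnKa : K.+1%:R * ln a <= (rho - 1) * L / 2.
  apply: (@le_trans _ _ ((2 * rho + 2) * (L / x) * ((c1 + 4 / g) * y))).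
    apply: (@le_trans _ _ (K.+1%:R * ((c1 + 4 / g) * y))); first by rewrite ler_wpM2l.
    by rewrite ler_wpM2r // mulr_ge0 ?addr_ge0 ?divr_ge0 // ltW.
  move: y3; rewrite ler_pdivrMr ?subr_gt0 //.
  move: (c1 + 4 / g) => c2 y3.
  have -> : (2 * rho + 2) * (L / x) * (c2 * y) = 2 * (2 * rho + 2) * c2 * (L / (2 * y)).
    by rewrite -yx; field; rewrite gt_eqF.
  have -> : (rho - 1) * L / 2 = y * (rho - 1) * (L / (2 * y)) by field; rewrite gt_eqF.
  by rewrite ler_wpM2r // divr_ge0 ?mulr_ge0 // ltW.
apply: (@le_trans _ _ (expR L * a ^+ K.+1 * expR (- (rho * L)))).
  rewrite ler_wpM2r ?expR_ge0 // -mulrA ler_wpM2l ?expR_ge0 //.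
  by rewrite exprS ler_wpM2r // exprn_ge0 // ltW.
have -> : a ^+ K.+1 = expR (K.+1%:R * ln a).
  by rewrite expRM_natl lnK // posrE.
rewrite -!expRD ler_expR.
move: (K.+1%:R * ln a) lnKa => t; clear; lra.
Qed.

(** The parameters of [upper_tail] can be chosen, for [n = expR L] vertices, so
    that it bounds the probability of an eigenvalue above
    [(1 + e) * L `^ alpha^-1] by [k / L `^ g], for a [g] that depends on
    [alpha] only. *)
Definition upper_tail_scale (alpha D k1 e k L : R) : Prop :=
  exists K m l0 S M rho,
   [/\ 0 < S, 0 < M & (0 < l0)%N] /\
   [/\ l0.+1%:R <= rho * l0%:R, S <= (K * l0)%:R, S <= m%:R & (l0 <= m)%N] /\
   (rho * S) `^ alpha^-1 + l0%:R `^ alpha^-1 * Num.sqrt M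
     < (1 + e) * L `^ alpha^-1 /\
   expR L * expR (- M) * k1
     + expR L * K.+1%:R * ((2 * K).+1%:R * m.+1%:R * D) ^+ K * expR (- S)
     + D ^+ 3 * expR (- (3 * l0)%:R) <= k / L `^ ((1 - alpha / 2) / 2).

(** The light edges contribute [l0 `^ alpha^-1 * Num.sqrt M], of order
    [L `^ (g / alpha + 1 / 2)], and [g] is such that this is
    [L `^ (alpha^-1 - g / alpha)]. *)
Lemma near_upper_tail_scale (alpha D k1 e : R) :
  0 < alpha -> alpha < 2 -> 1 <= D -> 0 < k1 -> 0 < e ->
  exists k : R, \forall L \near +oo, upper_tail_scale alpha D k1 e k L.
Proof.
move=> a0 a2 D1 k10 e0.
set g := (1 - alpha / 2) / 2.
have g0 : 0 < g by rewrite /g; lra.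
have g1 : g <= 1 by rewrite /g; lra.
have ga : 0 < g / alpha by rewrite divr_gt0.
(* [rho] enters twice: in the sum of the levels, [S = rho * L], and in the
   rounding of the levels. *)
pose rho := (1 + e / 2) `^ (alpha / 2).
have rho1 : 1 < rho.
  have := gt0_ltr_powR (r := alpha / 2) (divr_gt0 a0 (ltr0Sn _ _)) (x := 1) (y := 1 + e / 2).
  rewrite !nnegrE powR1; apply => //; lra.
have rho2 : (rho * rho) `^ alpha^-1 = 1 + e / 2.
  rewrite -expr2 -powR_mulrn ?powR_ge0 // /rho -!powRrM.
  rewrite (_ : alpha / 2 * (2 * alpha^-1) = 1); last by field; rewrite gt_eqF.
  by rewrite powRr1 //; lra.
pose c1 := (4 * rho + 4) * (rho + 2) * D.
have D0 : 0 < D by lra.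
have g20 : 0 < g / 2 by rewrite divr_gt0.
exists (k1 + 2 / (rho - 1) + 2 * D ^+ 3); near=> L.
have L1 : 1 <= L by near: L; apply: nbhs_pinfty_ge; exact: num_real.
have L0 : 0 < L by lra.
have x2 : 2 <= L `^ g by near: L; exact: near_powR_ge.
have xr : 2 / (rho - 1) <= L `^ g by near: L; exact: near_powR_ge.
have y1 : 1 <= L `^ (g / 2) by near: L; exact: near_powR_ge.
have y3 : 2 * (2 * rho + 2) * (c1 + 4 / g) / (rho - 1) <= L `^ (g / 2).
  by near: L; exact: near_powR_ge.
have z4 : 4 / e + 1 <= L `^ (g / alpha) by near: L; exact: near_powR_ge.
pose x := L `^ g; pose y := L `^ (g / 2).
have yx : y * y = x.
  by rewrite /x /y -powRD ?(gt_eqF L0) ?implybT // -splitr.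
rewrite -/x in x2 xr; rewrite -/y in y1 y3.
have xL : x <= L.
  by rewrite -[X in _ <= X](powRr1 (ltW L0)); apply: ler_powR.
have x0 : 0 < x by lra.
have y0 : 0 < y by lra.
pose l0 := Num.truncn x; pose S := rho * L; pose K := (Num.truncn (S / l0%:R)).+1.
pose m := (Num.truncn S).+1.
have S0 : 0 < S by rewrite mulr_gt0 //; lra.
have [lx lx'] := andP (truncn_itv (ltW x0)); rewrite -/l0 -natr1 in lx lx'.
have lx2 : x / 2 <= l0%:R by lra.
have l00 : 0 < l0%:R :> R by lra.
have SL0 : 0 <= S / l0%:R by rewrite divr_ge0 // ltW.
have [Kl Kl'] := andP (truncn_itv SL0); rewrite -/K in Kl'.
have [ml ml'] := andP (truncn_itv (ltW S0)); rewrite -/m in ml'.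
have KE : K%:R = (Num.truncn (S / l0%:R))%:R + 1 :> R by rewrite natr1.
have mE : m%:R = (Num.truncn S)%:R + 1 :> R by rewrite natr1.
exists K, m, l0, S, (2 * L), rho; split; first split => //.
- by rewrite mulr_gt0.
- by rewrite -(ltr0n R).
split; first split.
- have : 2 / (rho - 1) / 2 <= l0%:R by apply: le_trans lx2; lra.
  rewrite mulrAC divff // mul1r -natr1 -[_^-1]mul1r ler_pdivrMr ?subr_gt0 //; lra.
- by rewrite natrM -ler_pdivrMr // ltW.
- exact: ltW.
- rewrite -(ler_nat R); apply: (le_trans lx); apply: (le_trans xL).
  apply: (@le_trans _ _ S); last exact: ltW.
  by rewrite /S ler_peMl ?ltW.
split.
  have -> : (rho * S) `^ alpha^-1 = (1 + e / 2) * L `^ alpha^-1.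
    have rr0 : 0 <= rho * rho by rewrite mulr_ge0 ?powR_ge0.
    by rewrite /S mulrA powRM ?rho2 // ltW.
  have h1 : l0%:R `^ alpha^-1 <= L `^ (g / alpha).
    rewrite powRrM; apply: ge0_ler_powR; rewrite ?nnegrE ?invr_ge0 ?powR_ge0 //.
    exact: ltW.
  have h2 : Num.sqrt (2 * L) <= 2 * L `^ (2^-1).
    rewrite powR12_sqrt ?(ltW L0) // -[X in X * Num.sqrt L](_ : Num.sqrt (2 ^+ 2) = 2).
      rewrite -sqrtrM ?sqr_ge0 //; apply: ler_wsqrtr; rewrite expr2; lra.
    by rewrite sqrtr_sqr normr_nat.
  have h3 : L `^ alpha^-1 = L `^ (g / alpha) * (L `^ (g / alpha) * L `^ (2^-1)).
    rewrite -!powRD ?(gt_eqF L0) ?implybT //; congr (_ `^ _).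
    by rewrite /g; field; rewrite gt_eqF.
  have zL : 0 < L `^ (g / alpha) * L `^ (2^-1) by rewrite mulr_gt0 ?powR_gt0.
  suff : l0%:R `^ alpha^-1 * Num.sqrt (2 * L) < e / 2 * L `^ alpha^-1 by lra.
  apply: (@le_lt_trans _ _ (2 * (L `^ (g / alpha) * L `^ (2^-1)))).
    rewrite mulrCA; apply: ler_pM => //; exact: powR_ge0.
  rewrite h3 [e / 2 * _]mulrA ltr_pM2r //.
  have : 4 / e < L `^ (g / alpha) by lra.
  rewrite ltr_pdivrMr //; lra.
have iLx : L^-1 <= x^-1 by rewrite lef_pV2 ?posrE.
rewrite [X in _ <= X]mulrDl [X in _ <= X + _]mulrDl -/x.
apply: lerD; first apply: lerD.
- rewrite -expRD (_ : L + - (2 * L) = - L); last by ring.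
  rewrite mulrC ler_pM2l //; apply: le_trans iLx; exact: expRN_le.
- have Kb : K.+1%:R <= (2 * rho + 2) * (L / x).
    have LxE : 1 <= L / x by rewrite ler_pdivlMr // mul1r.
    have SLx : S / l0%:R <= 2 * rho * (L / x).
      rewrite ler_pdivrMr //.
      have -> : S = 2 * rho * (L / x) * (x / 2) by rewrite /S; field; rewrite gt_eqF.
      by rewrite ler_wpM2l // ltW // !mulr_gt0 ?invr_gt0 // (lt_trans _ rho1).
    rewrite -natr1 KE mulrDl; move: Kl SLx LxE; clear => h1 h2 h3.
    lra.
  have mb : m.+1%:R <= (rho + 2) * L.
    rewrite -natr1 mE mulrDl; move: ml L1; rewrite /S; clear => h1 h2.
    lra.
  apply: (le_trans (cluster_term_le rho1 D1 g0 L1 xL erefl Kb mb y1 y3)).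
  have r0 : 0 < (rho - 1) * L / 2 by rewrite !mulr_gt0 ?subr_gt0.
  apply: (le_trans (expRN_le r0)).
  have -> : ((rho - 1) * L / 2)^-1 = 2 / (rho - 1) * L^-1.
    by rewrite !invfM invrK; ring.
  by rewrite ler_wpM2l // divr_ge0 // subr_ge0 ltW.
- have l30 : 0 < (3 * l0)%:R :> R by rewrite natrM mulr_gt0.
  have -> : 2 * D ^+ 3 / x = D ^+ 3 * (2 / x) by ring.
  rewrite ler_wpM2l ?exprn_ge0 //; first by rewrite ltW.
  apply: (le_trans (expRN_le l30)).
  rewrite -[2 / x]invrK invf_div lef_pV2 ?posrE ?divr_gt0 //.
  by apply: (le_trans lx2); rewrite natrM ler_peMl ?ler1n // ltW.
Unshelve. all: by end_near. Qed.

End Asymptotics.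

(** * Convergence *)

Lemma cvg_ln_nat (R : realType) : ln (n%:R : R) @[n --> \oo] --> +oo.
Proof.
apply/cvgryPge => A; near=> n.
rewrite -[A]expRK ler_ln ?posrE ?expR_gt0 //.
  by near: n; exact: nbhs_infty_ger.
by rewrite ltr0n; near: n; exact: nbhs_infty_gt.
Unshelve. all: by end_near. Qed.

Lemma cvg_div_powR_ln (R : realType) (k g : R) : 0 < g ->
  (k / ln n%:R `^ g)%:E @[n --> \oo] --> 0%E.
Proof.
move=> g0; apply: cvg_EFin; first by apply: nearW.
rewrite -(mulr0 k); apply: cvgM; first exact: cvg_cst.
apply/gtr0_cvgV0.
  near=> n; apply: powR_gt0; near: n.
  exact: (cvgry_gt (@cvg_ln_nat R)).
apply/cvgryPge => A.
exact: (@cvg_ln_nat R _ (near_powR_ge A g0)).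
Unshelve. all: by end_near. Qed.

Section OneGraph.
Context (d : measure_display) (T : measurableType d) (R : realType)
  (P : probability T R) (n : nat) (p : R) (mu : probability R R)
  (G : T -> rel 'I_n) (Y : T -> 'M[R]_n).
Hypotheses (G_erdos_renyi : erdos_renyi P p G)
  (Y_iid : iid_symmetric_mx P mu Y)
  (XY_independent : independent P (sigma_mx (fun w => adjacency_mx R (G w)))
                                  (sigma_mx Y)).
Local Notation Z := (fun w => hadamard (adjacency_mx R (G w)) (Y w)).

Lemma measurable_lambda1_hadamard : (0 < n)%N ->
  measurable_fun setT (fun w => lambda1 (Z w)).
Proof.
move=> n0; apply: measurable_lambda1 => //.
  exact: (hadamard_sym G_erdos_renyi Y_iid).
move=> i j; under eq_fun do rewrite !mxE.
apply: measurable_funM; last exact: (measurable_weight Y_iid).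
have mG : measurable_fun setT (fun w => G w i j).
  apply: (measurable_fun_bool true); rewrite setTI.
  exact: (measurable_present G_erdos_renyi).
rewrite (_ : (fun w => _) = (fun b : bool => b%:R) \o (fun w => G w i j)) //.
exact: measurableT_comp.
Qed.

End OneGraph.

(** The expected number of edges of weight at least [(1 - e) * s] is of order
    [n `^ (1 - (1 - e) `^ alpha)]. *)
Lemma lower_tail_bound (R : realType) (d alpha e C1 : R) :
  0 < d -> 0 < alpha -> 0 < C1 -> 0 < e -> e <= 1 / 2 ->
  exists2 k : R, 0 <= k & \forall n \near \oo,
    forall q : R, C1 / 2 * expR (- (((1 - e) * ln n%:R `^ alpha^-1) `^ alpha)) <= q ->
    expR (- (d / n%:R * q * (n%:R * (n%:R - 1) / 2))) <= k / ln n%:R.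
Proof.
move=> d0 a0 C10 e0 e1.
pose b := (1 - e) `^ alpha.
have b1 : 0 < 1 - b.
  rewrite subr_gt0 /b.
  have := gt0_ltr_powR a0 (x := 1 - e) (y := 1).
  rewrite !nnegrE powR1; apply; lra.
exists (8 / (d * C1 * (1 - b))); first by rewrite divr_ge0 // !mulr_ge0 // ltW.
near=> n => q hq.
have L0 : 0 < ln n%:R :> R by near: n; exact: (cvgry_gt (@cvg_ln_nat R)).
have n2 : 2 <= n%:R :> R by near: n; exact: nbhs_infty_ger.
have n0 : 0 < n%:R :> R by lra.
move: hq; rewrite powRM ?powR_ge0 //; last lra.
rewrite -powRrM mulVf ?gt_eqF // powRr1 ?(ltW L0) // -/b => hq.
set L := ln n%:R in L0 hq *.
have nL : n%:R = expR L by rewrite /L lnK // posrE.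
have h1 : d * C1 / 8 * ((1 - b) * L) <= d / n%:R * q * (n%:R * (n%:R - 1) / 2).
  have -> : d / n%:R * q * (n%:R * (n%:R - 1) / 2) = d * q * (n%:R - 1) / 2.
    by field; rewrite gt_eqF.
  apply: (@le_trans _ _ (d * (C1 / 2 * expR (- (b * L))) * (n%:R / 2) / 2)).
    have -> : d * (C1 / 2 * expR (- (b * L))) * (n%:R / 2) / 2
      = d * C1 / 8 * (expR L * expR (- (b * L))) by rewrite nL; field.
    rewrite -expRD ler_wpM2l ?divr_ge0 ?mulr_ge0 ?(ltW d0) ?(ltW C10) //.
    have -> : L + - (b * L) = (1 - b) * L by ring.
    by apply: le_trans (expR_ge1Dx _); rewrite lerDr.
  have q0 : 0 <= C1 / 2 * expR (- (b * L)) by rewrite mulr_ge0 ?expR_ge0 ?divr_ge0 ?(ltW C10).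
  rewrite ler_wpM2r //; apply: ler_pM.
  - exact: mulr_ge0 (ltW d0) q0.
  - by rewrite divr_ge0 // ltW.
  - by rewrite ler_wpM2l // ltW.
  - by move: n2; clear; lra.
have k0 : 0 < d * C1 / 8 * ((1 - b) * L) by rewrite !mulr_gt0.
apply: (@le_trans _ _ (expR (- (d * C1 / 8 * ((1 - b) * L))))).
  by rewrite ler_expR lerN2.
apply: (le_trans (expRN_le k0)); rewrite le_eqVlt; apply/orP; left; apply/eqP.
by field; rewrite !gt_eqF.
Unshelve. all: by end_near. Qed.

Theorem corollary1p7 (R : realType) (d alpha : R)
    (disp : nat -> measure_display) (T : forall n, measurableType (disp n))
    (P : forall n, probability (T n) R) (mu : probability R R)
    (G : forall n, T n -> rel 'I_n) (Y : forall n, T n -> 'M[R]_n)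
    (d_gt0 : 0 < d) (alpha_gt0 : 0 < alpha) (alpha_lt2 : alpha < 2)
    (mu_weibull : weibull alpha mu)
    (G_erdos_renyi : forall n, d <= n%:R ->
      erdos_renyi (P n) (d / n%:R) (G n))
    (Y_iid : forall n, d <= n%:R -> iid_symmetric_mx (P n) mu (Y n))
    (XY_independent : forall n, d <= n%:R ->
      independent (P n) (sigma_mx (fun w => adjacency_mx R (G n w)))
                        (sigma_mx (Y n))) :
  cvg_in_probability P
    (fun n w => lambda1 (hadamard (adjacency_mx R (G n w)) (Y n w))
                / (ln n%:R `^ alpha^-1))
    1.
Proof.
move=> eps eps0.
pose e := Num.min eps (1 / 2).
have e0 : 0 < e by rewrite lt_min eps0 /= divr_gt0.
have e1 : e <= 1 / 2 by rewrite ge_min lexx orbT.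
have [C C0 hC] := weibull_level alpha_gt0 mu_weibull.
(* The union bound over clusters wants [1 <= d * C'], for the largest clusters
   to dominate. *)
pose C' := C + d^-1.
have C'0 : 0 < C' by rewrite addr_gt0 // invr_gt0.
have dC' : 1 <= d * C'.
  by rewrite mulrDr divff ?gt_eqF // lerDr mulr_ge0 // ltW.
have hC' l : (mu (level alpha l) <= (C' * expR (- l%:R))%:E)%E.
  apply: (le_trans (hC l)); rewrite lee_fin ler_wpM2r ?expR_ge0 //.
  by rewrite lerDl invr_ge0 ltW.
have [C1 [C2 [C10 _ hw]]] := mu_weibull.
have [k1 hk1] := near_upper_tail_scale alpha_gt0 alpha_lt2 dC'
  (expR_gt0 (d * expR (1 + d * expR 2))) e0.
have e20 : 0 < e / 2 by rewrite divr_gt0.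
have e21 : e / 2 <= 1 / 2 by lra.
have [k2 k20 hk2] := lower_tail_bound d_gt0 alpha_gt0 C10 e20 e21.
pose g := (1 - alpha / 2) / 2.
have g0 : 0 < g by rewrite /g; lra.
have g1 : g <= 1 by rewrite /g; lra.
apply: (@squeeze_cvge _ _ _ _ (fun=> 0%E) _ (fun n => ((k1 + k2) / ln n%:R `^ g)%:E)).
- near=> n; rewrite measure_ge0 /=.
  have dn : d <= n%:R by near: n; exact: nbhs_infty_ger.
  have nr0 : 0 < n%:R :> R by exact: lt_le_trans dn.
  have n0 : (0 < n)%N by rewrite -(ltr0n R).
  have GE := G_erdos_renyi n dn; have YI := Y_iid n dn.
  have XY := XY_independent n dn.
  have L1 : 1 <= ln n%:R :> R.
    by near: n; exact: (cvgry_ge (@cvg_ln_nat R)).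
  have s2 : 2 <= ln n%:R `^ alpha^-1.
    near: n; apply: (@cvg_ln_nat R _ (near_powR_ge _ _)).
    by rewrite invr_gt0.
  set s := ln n%:R `^ alpha^-1 in s2 *.
  have s0 : 0 < s by lra.
  have p01 : 0 <= d / n%:R <= 1.
    by rewrite divr_ge0 ?(ltW d_gt0) //= ler_pdivrMr // mul1r.
  have [p0 _] := andP p01.
  pose lam w := lambda1 (hadamard (adjacency_mx R (G n w)) (Y n w)).
  have ml : measurable_fun setT lam := measurable_lambda1_hadamard GE YI n0.
  pose A := [set w | (1 + e) * s <= lam w].
  pose B := [set w | lam w <= (1 - e) * s].
  have mA : measurable A.
    by rewrite -[A]setTI; apply: measurable_fun_le => //; exact: measurable_cst.
  have mB : measurable B.
    by rewrite -[B]setTI; apply: measurable_fun_le => //; exact: measurable_cst.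
  have PA : (P n A <= (k1 / ln n%:R `^ g)%:E)%E.
    have [K [m [l0 [S [M [rho [[S0 M0 l00] [[hr SK Sm lm] [hlt hle]]]]]]]]] :
        upper_tail_scale alpha (d * C') (expR (d * expR (1 + d * expR 2))) e k1
          (ln n%:R).
      by near: n; exact: (@cvg_ln_nat R _ hk1).
    apply: (le_trans (upper_tail GE YI XY p0 (divfK (lt0r_neq0 nr0) d) n0
      alpha_gt0 alpha_lt2 C'0 dC' hC' S0 M0 l00 hr SK Sm lm mA _)).
      by move=> w; apply: lt_le_trans.
    rewrite lee_fin; apply: le_trans hle.
    by rewrite lnK ?posrE.
  have PB : (P n B <= (k2 / ln n%:R `^ g)%:E)%E.
    (* Half of [e] is given up to turn the large inequality in [B] into a
       strict one. *)
    pose t := (1 - e / 2) * s.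
    have t1 : 1 < t by rewrite /t; move: e1 s2; clear; nra.
    apply: (le_trans (lower_tail GE YI XY p01 (t := t) mB _)).
      move=> w /le_lt_trans; apply; rewrite /t ltr_pM2r //; lra.
    rewrite lee_fin; apply: (@le_trans _ _ (k2 / ln n%:R)).
      apply: (near hk2 n) => //.
      have mt : measurable [set x : R | t <= x].
        rewrite (_ : mkset _ = `[t, +oo[%classic) //.
        by apply/seteqP; split=> x; rewrite /= in_itv /= andbT.
      rewrite -lee_fin fineK ?fin_num_measure //.
      by have [/andP[] ] := hw t t1.
    rewrite ler_wpM2l // lef_pV2 ?posrE ?powR_gt0 ?(lt_le_trans _ L1) //.
    rewrite -[X in _ <= X]powRr1 ?(le_trans _ L1) //.
    exact: ler_powR.
  have mV : measurable_fun setT (fun w => `|lam w / s - 1|).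
    apply: measurableT_comp => //; apply: measurable_funB => //.
    by apply: measurable_funM.
  apply: (@le_trans _ _ (P n (A `|` B))).
    apply: le_measure; rewrite ?inE.
    - by rewrite -[mkset _]setTI; apply: measurable_fun_le => //; exact: measurable_cst.
    - exact: measurableU.
    - move=> w /= hV.
      have : e <= `|lam w / s - 1| by apply: le_trans hV; rewrite ge_min lexx.
      rewrite ler_normr => /orP[h|h]; [left|right]; rewrite /A /B /=.
        by rewrite -ler_pdivlMr //; lra.
      by rewrite -ler_pdivrMr //; lra.
  apply: (le_trans (measureU2 _ mA mB)).
  by rewrite mulrDl EFinD; apply: leeD.
- exact: cvg_cst.
- exact: cvg_div_powR_ln.
Unshelve. all: by end_near. Qed.
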